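(* Let $A$ be a Chébli–Trimèche function satisfying the standing assumptions in the context, with associated function $c$. Let $1<p<\infty$ and $u_0\in L^2(\mathbb{R}_+,A\,dx)$. Suppose that $B$ is a Fourier multiplier from $L^2(\mathbb{R}_+,A\,dx)$ into $L^{2p}(\mathbb{R}_+,A\,dx)$ such that its symbol $h$ satisfies $$\sup_{s>0}\, s\left[\int_{\{\lambda\in\mathbb{R}_+:\,|h(\lambda)|\geq s\}}|c(\lambda)|^{-2}\,d\lambda\right]<\infty.$$ Then the Cauchy problem $$u_t-|Bu(t)|^p=0,\qquad u(0)=u_0,$$ has a local solution in the space $L^\infty(0,T^*;L^2(\mathbb{R}_+,A\,dx))$ for some $T^*>0$.
   Context: Write $\mathbb{R}_+=[0,\infty)$, $\mathbb{R}_+^*=(0,\infty)$. A Chébli–Trimèche function is a function $A$ continuous on $\mathbb{R}_+$ and twice continuously differentiable on $\mathbb{R}_+^*$ such that: (i) $A(0)=0$ and $A>0$ on $\mathbb{R}_+^*$; (ii) $A$ is increasing and $A(x)\to\infty$ as $x\to\infty$; (iii) $A'/A$ is a decreasing $C^\infty$ function on $\mathbb{R}_+^*$, hence $\rho:=\frac12\lim_{x\to\infty}\frac{A'(x)}{A(x)}\ge0$ exists; (iv) $\frac{A'(x)}{A(x)}=\frac{2\alpha+1}{x}+B_0(x)$ near $0$, where $\alpha>-\frac12$ and $B_0$ is an odd $C^\infty$ function on $\mathbb{R}$. Let $L=-\frac{d^2}{dx^2}-\frac{A'(x)}{A(x)}\frac{d}{dx}$. For $\lambda\in\mathbb{C}$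 let $\phi_\lambda$ be the unique solution on $\mathbb{R}_+^*$ of $L\phi_\lambda=(\lambda^2+\rho^2)\phi_\lambda$ that extends continuously to $0$ with $\phi_\lambda(0)=1$. The Fourier transform of $f\in L^1(\mathbb{R}_+,A\,dx)$ is $\widehat f(\lambda)=\int_0^\infty f(x)\phi_\lambda(x)A(x)\,dx$ for $\lambda\in\mathbb{R}_+\cup[0,i\rho]$. There is a unique nonnegative (Plancherel) measure $\pi$ on $\mathbb{R}_+\cup[0,i\rho]$, with support $[0,\infty)$, such that the Fourier transform induces an isometric isomorphism from $L^2(\mathbb{R}_+,A\,dx)$ onto $L^2(\pi)$. Condition (P): a function $f$ satisfies Condition (P) if for some $a>0$, $f(x)=\frac{a^2-\frac14}{x^2}+\zeta(x)$ for all large $x$, where for some $x_0>0$, $\int_{x_0}^\infty x^{\gamma(a)}|\zeta(x)|\,dx<\infty$ and $\zeta$ is bounded for $x>x_0$; here $\gamma(a)=a+\frac12$ if $a\ge\frac12$ and $\gamma(a)=1$ otherwise. Standing assumptions: $\alpha\ge0$; the function $G(x)=\frac14\left(\frac{A'(x)}{A(x)}\right)^2+\frac12\frac{d}{dx}\left(\frac{A'(x)}{A(x)}\right)-\rho^2$ satisfies Condition (P) with constant $a$, together with at least one of: (1) $a>\frac12$; (2) $a\ne|\alpha|$; (3) $a=\alpha\le\frac12$ and either $\int_0^\infty x^{\frac12-\alpha}\zeta(x)\phi_0(x)A(x)^{\frac12}dx\ne-2\alpha\sqrt{M_A}$ or $\int_0^\infty x^{\frac12+\alpha}\zeta(x)\phi_0(x)A(x)^{\frac12}dx=0$,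 where $M_A=\lim_{x\to0^+}x^{-2\alpha-1}A(x)$ and $\zeta(x)=G(x)+(\frac14-a^2)/x^2$. If $\rho=0$, also $A(x)=O(x^{2\alpha+1})$ as $x\to\infty$. Under these assumptions (a known result of Bloom and Xu) $d\pi(\lambda)=C_0|c(\lambda)|^{-2}d\lambda$ on $[0,\infty)$ with $C_0>0$, where $c$ is a complex function on $\mathbb{C}\setminus\{0\}$ for which there are positive constants $C_1,C_2,K$ such that for all $\lambda$ with $\mathrm{Im}(\lambda)\le0$: $C_1|\lambda|^{a+\frac12}\le|c(\lambda)|^{-1}\le C_2|\lambda|^{a+\frac12}$ if $|\lambda|\le K$, and $C_1|\lambda|^{\alpha+\frac12}\le|c(\lambda)|^{-1}\le C_2|\lambda|^{\alpha+\frac12}$ if $|\lambda|>K$. A Fourier multiplier with symbol $h\in L^\infty(\pi)$ is the linear operator $B$ with $\widehat{Bf}(\lambda)=h(\lambda)\widehat f(\lambda)$, defined on $L^2(\mathbb{R}_+,A\,dx)$. A local solution of the Cauchy problem is a function $u$ satisfying $$u(t)=u_0+\int_0^t|Bu(\tau)|^p\,d\tau$$ in the space $L^\infty(0,T^*;L^2(\mathbb{R}_+,A\,dx))$ for some $T^*>0$. *)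

(* Defs.v *)
From HB Require Import structures.
From mathcomp Require Import all_boot all_order all_algebra.
From mathcomp Require Import complex.
From mathcomp Require Import all_classical all_reals all_analysis.

Set Implicit Arguments.
Unset Strict Implicit.
Unset Printing Implicit Defensive.

Import Order.TTheory GRing.Theory Num.Theory.
Import numFieldNormedType.Exports.

Local Open Scope classical_set_scope.
Local Open Scope ring_scope.
Local Open Scope complex_scope.

Notation cmod z := (ComplexField.Normc.normc z).

Section chebli_trimeche.
Context {R : realType}.
Implicit Types (A f : R -> R) (alpha a x : R).

Definition leb : {measure set (measurableTypeR R) -> \bar R} :=
  @lebesgue_measure R.

Definition smooth_at f x := forall n : nat, derivable (derive1n n f) x 1.

Definition logder A x := derive1 A x / A x.

Definition rho A : R := 2^-1 * lim (logder A x @[x --> +oo]).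

(* "Increasing" and "decreasing" are read in the weak sense; for A this makes
   no difference in the presence of the other conditions. *)
Record is_chebli_trimeche A alpha : Prop := {
  ct_cont : {within `[0, +oo[, continuous A};
  ct_C2 : forall x, 0 < x ->
    [/\ derivable A x 1, derivable (derive1 A) x 1 & {for x, continuous (derive1n 2 A)}];
  ct_0 : A 0 = 0;
  ct_gt0 : forall x, 0 < x -> 0 < A x;
  ct_incr : forall x y, 0 <= x -> x <= y -> A x <= A y;
  ct_infty : A x @[x --> +oo] --> +oo;
  ct_logder_decr : forall x y, 0 < x -> x <= y -> logder A y <= logder A x;
  ct_logder_smooth : forall x, 0 < x -> smooth_at (logder A) x;
  ct_alpha : - 2^-1 < alpha;
  ct_near0 : exists B0 : R -> R,
    [/\ forall x, B0 (- x) = - B0 x,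
        forall x, smooth_at B0 x
      & \forall x \near 0^'+, logder A x = (2 * alpha + 1) / x + B0 x] }.

Definition cderive (f : R -> R[i]) (x : R) : R[i] :=
  derive1 (fun y => complex.Re (f y)) x +i* derive1 (fun y => complex.Im (f y)) x.

Definition cderivable (f : R -> R[i]) (x : R) : Prop :=
  derivable (fun y => complex.Re (f y)) x 1 /\
  derivable (fun y => complex.Im (f y)) x 1.

Definition is_eigenfunction A (lambda : R[i]) (f : R -> R[i]) : Prop :=
  [/\ forall x, 0 < x -> cderivable f x /\ cderivable (cderive f) x,
      forall x, 0 < x ->
        - cderive (cderive f) x - (logder A x)%:C * cderive f x
        = (lambda ^+ 2 + ((rho A) ^+ 2)%:C) * f x,
      f 0 = 1
    & (complex.Re (f x) @[x --> 0^'+] --> (1 : R)) /\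
      (complex.Im (f x) @[x --> 0^'+] --> (0 : R)) ].

Definition Gfun A x : R :=
  4^-1 * (logder A x) ^+ 2 + 2^-1 * derive1 (logder A) x - (rho A) ^+ 2.

Definition gamma a : R := if 2^-1 <= a then a + 2^-1 else 1.

Definition conditionP f a : Prop :=
  0 < a /\ exists zeta : R -> R,
    (\forall x \near +oo, f x = (a ^+ 2 - 4^-1) / x ^+ 2 + zeta x) /\
    exists x0 : R,
      [/\ 0 < x0,
          leb.-integrable `]x0, +oo[ (fun x => (x `^ gamma a * `|zeta x|)%:E)
        & exists M : R, forall x, x0 < x -> `|zeta x| <= M].

Definition MA A alpha : R := lim ((x `^ (- 2 * alpha - 1) * A x) @[x --> 0^'+]).

Definition zetafun A a x : R := Gfun A x + (4^-1 - a ^+ 2) / x ^+ 2.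

(* phi 0 is real-valued, whence the real part.  The integral takes values in
   \bar R, so that an equality to a real number entails integrability. *)
Definition zeta_integral A (phi : R[i] -> R -> R[i]) a (b : R) : \bar R :=
  (\int[leb]_(x in `]0%R, +oo[)
    (x `^ b * zetafun A a x * complex.Re (phi 0 x) * Num.sqrt (A x))%:E)%E.

Definition standing_assumptions A (phi : R[i] -> R -> R[i]) alpha a : Prop :=
  [/\ 0 <= alpha,
      conditionP (Gfun A) a,
      [\/ 2^-1 < a,
          a <> `|alpha|
        | [/\ a = alpha, alpha <= 2^-1
            & zeta_integral A phi a (2^-1 - alpha)
                <> (- 2 * alpha * Num.sqrt (MA A alpha))%:E
              \/ zeta_integral A phi a (2^-1 + alpha) = 0%E]]
    & rho A = 0 ->
        exists C : R, \forall x \near +oo, `|A x| <= C * x `^ (2 * alpha + 1)].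

End chebli_trimeche.

Section complex_Lp.
Context {R : realType} {d : measure_display} {T : measurableType d}.
Implicit Types (mu : {measure set T -> \bar R}) (p : \bar R) (f g : T -> R[i]).

Definition cmeasurable f : Prop :=
  measurable_fun setT (fun x => complex.Re (f x)) /\
  measurable_fun setT (fun x => complex.Im (f x)).

Definition cLnorm mu p f : \bar R := Lnorm mu p (fun x => (cmod (f x))%:E).

(* Representatives: elements of L^p are these functions up to equality a.e. *)
Definition cLp mu p f : Prop := cmeasurable f /\ (cLnorm mu p f < +oo)%E.

Definition cintegral mu f : R[i] :=
  (\int[mu]_x complex.Re (f x))%R +i* (\int[mu]_x complex.Im (f x))%R.

End complex_Lp.

Definition linear_on_L2 {R : realType} {d1 d2 : measure_display}
    {T1 : measurableType d1} {T2 : measurableType d2}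
    (mu : {measure set T1 -> \bar R}) (nu : {measure set T2 -> \bar R})
    (F : (T1 -> R[i]) -> T2 -> R[i]) : Prop :=
  forall (k : R[i]) (f g : T1 -> R[i]), cLp mu 2%:E f -> cLp mu 2%:E g ->
    \forall y \ae nu, F (fun x => k * f x + g x) y = k * F f y + F g y.

Section fourier.
Context {R : realType}.

Definition Cborel := g_sigma_algebraType (@open R[i]^o).

Definition is_weighted_measure (A : R -> R)
    (mu : {measure set (measurableTypeR R) -> \bar R}) : Prop :=
  forall S : set (measurableTypeR R), measurable S ->
    mu S = (\int[leb]_(x in S `&` `[0%R, +oo[) (A x)%:E)%E.

Definition spectrum (A : R -> R) : set Cborel :=
  [set z : R[i] | (complex.Im z = 0 /\ 0 <= complex.Re z) \/
                  (complex.Re z = 0 /\ 0 <= complex.Im z <= rho A)].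

Definition msupport (nu : {measure set Cborel -> \bar R}) : set Cborel :=
  [set z | forall U : set R[i]^o, open U -> U z -> (0 < nu U)%E].

Definition fourier (mu : {measure set (measurableTypeR R) -> \bar R})
    (phi : R[i] -> R -> R[i]) (f : R -> R[i]) (lambda : R[i]) : R[i] :=
  cintegral mu (fun x => f x * phi lambda x).

(* pi is the Plancherel measure and FT the extension of the Fourier transform
   to an isometric isomorphism of L^2(mu) onto L^2(pi). *)
Record is_plancherel (A : R -> R)
    (mu : {measure set (measurableTypeR R) -> \bar R})
    (phi : R[i] -> R -> R[i])
    (pi : {measure set Cborel -> \bar R})
    (FT : (R -> R[i]) -> Cborel -> R[i]) : Prop := {
  pl_spectrum : pi.-negligible (~` spectrum A);
  pl_support : msupport pi =
    [set z : R[i] | complex.Im z = 0 /\ 0 <= complex.Re z];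
  pl_extends : forall f, cLp mu 1%:E f -> cLp mu 2%:E f ->
    \forall lambda \ae pi, FT f lambda = fourier mu phi f lambda;
  pl_linear : linear_on_L2 mu pi FT;
  pl_into : forall f, cLp mu 2%:E f -> cLp pi 2%:E (FT f);
  pl_isometry : forall f, cLp mu 2%:E f ->
    cLnorm pi 2%:E (FT f) = cLnorm mu 2%:E f;
  pl_onto : forall F, cLp pi 2%:E F ->
    exists2 f, cLp mu 2%:E f & \forall lambda \ae pi, FT f lambda = F lambda }.

(* c is only meant on C \ {0}: its value at 0 plays no role. *)
Record is_c_function (alpha a : R) (pi : {measure set Cborel -> \bar R})
    (c : R[i] -> R[i]) : Prop := {
  cf_measurable :
    measurable_fun (`]0, +oo[ : set (measurableTypeR R)) (fun l => cmod (c l%:C));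
  cf_density : exists2 C0 : R, 0 < C0 &
    forall S : set Cborel, measurable S ->
      pi S = (C0%:E * \int[leb]_(l in [set l : R | (0 <= l)%R /\ S l%:C])
                        (cmod (c l%:C) ^- 2)%:E)%E;
  cf_bounds : exists C1 C2 K : R,
    [/\ 0 < C1, 0 < C2, 0 < K
      & forall lambda : R[i], lambda != 0 -> complex.Im lambda <= 0 ->
          (cmod lambda <= K ->
            C1 * cmod lambda `^ (a + 2^-1) <= (cmod (c lambda))^-1
              <= C2 * cmod lambda `^ (a + 2^-1)) /\
          (K < cmod lambda ->
            C1 * cmod lambda `^ (alpha + 2^-1) <= (cmod (c lambda))^-1
              <= C2 * cmod lambda `^ (alpha + 2^-1))] }.

Definition is_fourier_multiplier
    (mu : {measure set (measurableTypeR R) -> \bar R})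
    (pi : {measure set Cborel -> \bar R})
    (FT : (R -> R[i]) -> Cborel -> R[i])
    (h : Cborel -> R[i]) (B : (R -> R[i]) -> R -> R[i]) : Prop :=
  [/\ cLp pi +oo%E h,
      linear_on_L2 mu mu B
    & forall f, cLp mu 2%:E f -> cLp mu 2%:E (B f) /\
        \forall lambda \ae pi, FT (B f) lambda = h lambda * FT f lambda].

End fourier.

Section bochner.
Context {R : realType} (mu : {measure set (measurableTypeR R) -> \bar R}).
Implicit Types (D : set R) (F s : R -> R -> R[i]) (v : R -> R[i]).

Definition L2dist (f g : R -> R[i]) : \bar R :=
  cLnorm mu 2%:E (fun x => f x - g x).

(* The L^2-valued functions below take values in representatives; limits and
   equalities between them are always taken in the L^2 norm or a.e. *)
Definition simple_L2 s : Prop :=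
  [/\ finite_set (range s),
      forall v, measurable (s @^-1` [set v] : set (measurableTypeR R))
    & forall t, cLp mu 2%:E (s t)].

(* Meant for D of finite measure. *)
Definition simple_integral D s : R -> R[i] := fun x =>
  \sum_(v \in range s) (fine (leb (D `&` s @^-1` [set v])))%:C * v x.

Definition simple_approx D F (s : nat -> R -> R -> R[i]) : Prop :=
  (forall n, simple_L2 (s n)) /\
  (\forall t \ae leb, D t -> L2dist (F t) (s n t) @[n --> \oo] --> 0%E).

Definition strongly_measurable D F : Prop :=
  exists s : nat -> R -> R -> R[i], simple_approx D F s.

Definition is_bochner_integral D F v : Prop :=
  cLp mu 2%:E v /\ (\forall t \ae leb, D t -> cLp mu 2%:E (F t)) /\
  exists s : nat -> R -> R -> R[i],
    [/\ simple_approx D F s,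
        (\int[leb]_(t in D) L2dist (F t) (s n t))%E @[n --> \oo] --> 0%E
      & L2dist (simple_integral D (s n)) v @[n --> \oo] --> 0%E].

Definition Linfty_L2 (T : R) (u : R -> R -> R[i]) : Prop :=
  strongly_measurable `]0, T[ u /\
  exists M : R, \forall t \ae leb, 0 < t < T ->
    cLp mu 2%:E (u t) /\ (cLnorm mu 2%:E (u t) <= M%:E)%E.

Definition is_local_solution (B : (R -> R[i]) -> R -> R[i]) (p : R)
    (u0 : R -> R[i]) (T : R) (u : R -> R -> R[i]) : Prop :=
  Linfty_L2 T u /\
  \forall t \ae leb, 0 < t < T ->
    exists2 v : R -> R[i],
      is_bochner_integral `]0, t[
        (fun tau x => (cmod (B (u tau) x) `^ p)%:C) v
      & \forall x \ae mu, u t x = u0 x + v x.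

End bochner.

(* Main.v *)
Require Import Defs.
From HB Require Import structures.
From mathcomp Require Import all_boot all_order all_algebra.
From mathcomp Require Import complex.
From mathcomp Require Import all_classical all_reals all_analysis.
From mathcomp Require Import measurable_realfun ess_sup_inf.
From mathcomp Require Import ring lra.
Import Order.TTheory GRing.Theory Num.Theory.
Import numFieldNormedType.Exports.
Local Open Scope classical_set_scope.
Local Open Scope ring_scope.
Local Open Scope complex_scope.

(** The nonlinearity [Phi f = |B f|^p] is a locally Lipschitz map
of [L^2] into itself, so that the Cauchy problem is an autonomous ordinary
differential equation [u' = Phi u] in a Banach space and has a local solution.

Why [Phi] is locally Lipschitz.  By the Plancherel isometry a multiplier with
essentially bounded symbol is bounded on [L^2] ([multiplier_bounded]).  As [B]
also maps [L^2] into [L^{2p}], the closed graph theorem makes it bounded from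
[L^2] to [L^{2p}] ([L2_Lq_bounded]): the sublevel sets of [f |-> |B f|_{2p}] are
closed in [L^2] by Fatou's lemma, and an unbounded [B] would allow a sequence of
nested balls on which this norm exceeds [0, 1, 2, ...], whose common point
contradicts [B f] being in [L^{2p}].  The inequality
[|a^p - b^p| <= p (a + b)^(p-1) |a - b|] and Hoelder's inequality with exponents
[p] and [p / (p - 1)] then bound [|Phi f - Phi g|_2] by a constant times
[|f - g|_2] as long as [f] and [g] stay in a ball ([norm_le_powR_dist]).

Why the equation has a solution in the sense of Bochner.  The Euler polygons
with steps [T / 2^n] converge at the rate [2^-n]: halving the step perturbs the
nodes by [O(2^-n)] ([euler_refine]), and a sequence with such consecutive
distances has a limit in [L^2] by Riesz and Fischer ([riesz_fischer]).  The step
functions [w_n] which take the value of the last node are simple functions of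
time and converge uniformly to the limit [u].  The slopes [Phi w_n] are simple
too and converge uniformly to [Phi u], and their integral over [(0, t)] is by
construction the increment of the Euler polygon ([euler_simple_integral]).  They
thus witness that the Bochner integral of [Phi u] over [(0, t)] is [u t - u0]. *)

Set Implicit Arguments.
Unset Strict Implicit.
Unset Printing Implicit Defensive.

(** * Complex-valued measurable functions *)

Section modulus.
Context {R : realType}.
Implicit Types z w : R[i].

Lemma cmod_ge0 z : 0 <= cmod z.
Proof. by case: z => a b; exact: sqrtr_ge0. Qed.

Lemma cmodD z w : cmod (z + w) <= cmod z + cmod w.
Proof. exact: le_normcD. Qed.

Lemma cmodN z : cmod (- z) = cmod z.
Proof. exact: normcN. Qed.

Lemma cmodM z w : cmod (z * w) = cmod z * cmod w.
Proof. exact: ComplexField.Normc.normcM. Qed.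

Lemma cmod0 : cmod (0 : R[i]) = 0.
Proof. exact: ComplexField.Normc.normc0. Qed.

Lemma cmodR (x : R) : 0 <= x -> cmod x%:C = x.
Proof. by move=> x0; rewrite /= expr0n/= addr0 sqrtr_sqr ger0_norm. Qed.

Lemma cmodR_norm (x : R) : cmod x%:C = `|x|.
Proof. by rewrite /= expr0n/= addr0 sqrtr_sqr. Qed.

Lemma cmod_distC z w : cmod (z - w) = cmod (w - z).
Proof. by rewrite -cmodN opprB. Qed.

Lemma ler_cmod_dist z w : `|cmod z - cmod w| <= cmod (z - w).
Proof.
rewrite ler_norml; apply/andP; split.
  rewrite lerNl opprB lerBlDr cmod_distC.
  by apply: le_trans (cmodD _ _); rewrite subrK.
by rewrite lerBlDr; apply: le_trans (cmodD _ _); rewrite subrK.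
Qed.

Lemma cmod_sqrt z : cmod z = Num.sqrt (complex.Re z ^+ 2 + complex.Im z ^+ 2).
Proof. by case: z. Qed.

Lemma Re_le_cmod z : `|complex.Re z| <= cmod z.
Proof.
rewrite cmod_sqrt -(sqrtr_sqr (complex.Re z)) ler_sqrt ?lerDl ?sqr_ge0//.
by rewrite addr_ge0 ?sqr_ge0.
Qed.

Lemma Im_le_cmod z : `|complex.Im z| <= cmod z.
Proof.
rewrite cmod_sqrt -(sqrtr_sqr (complex.Im z)) ler_sqrt ?lerDr ?sqr_ge0//.
by rewrite addr_ge0 ?sqr_ge0.
Qed.

Lemma ReD z w : complex.Re (z + w) = complex.Re z + complex.Re w.
Proof. by case: z; case: w. Qed.

Lemma ImD z w : complex.Im (z + w) = complex.Im z + complex.Im w.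
Proof. by case: z; case: w. Qed.

Lemma ReN z : complex.Re (- z) = - complex.Re z.
Proof. by case: z. Qed.

Lemma ImN z : complex.Im (- z) = - complex.Im z.
Proof. by case: z. Qed.

Lemma ReM z w : complex.Re (z * w) =
  complex.Re z * complex.Re w - complex.Im z * complex.Im w.
Proof. by case: z; case: w. Qed.

Lemma ImM z w : complex.Im (z * w) =
  complex.Re z * complex.Im w + complex.Im z * complex.Re w.
Proof. by case: z; case: w. Qed.

Lemma cvg_cmod (z : nat -> R[i]) w :
  complex.Re (z n) @[n --> \oo] --> complex.Re w ->
  complex.Im (z n) @[n --> \oo] --> complex.Im w ->
  cmod (z n) @[n --> \oo] --> cmod w.
Proof.
move=> zr zi; under eq_fun do rewrite cmod_sqrt.
rewrite cmod_sqrt; apply: continuous_cvg; first exact: sqrt_continuous.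
by apply: cvgD; rewrite expr2; under eq_fun do rewrite expr2; exact: cvgM.
Qed.

End modulus.

Section cmeasurable.
Context {R : realType} {d : measure_display} {T : measurableType d}.
Implicit Types f g : T -> R[i].

Lemma cmeasurableD f g : cmeasurable f -> cmeasurable g ->
  cmeasurable (fun x => f x + g x).
Proof.
move=> [fr fi] [gr gi]; split.
- by under eq_fun do rewrite ReD; exact: measurable_funD.
- by under eq_fun do rewrite ImD; exact: measurable_funD.
Qed.

Lemma cmeasurableB f g : cmeasurable f -> cmeasurable g ->
  cmeasurable (fun x => f x - g x).
Proof.
move=> [fr fi] [gr gi]; split.
- by under eq_fun do rewrite ReD ReN; exact: measurable_funB.
- by under eq_fun do rewrite ImD ImN; exact: measurable_funB.
Qed.

Lemma cmeasurableZ k f : cmeasurable f -> cmeasurable (fun x => k * f x).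
Proof.
move=> [fr fi]; split.
- under eq_fun do rewrite ReM.
  by apply: measurable_funB; apply: measurable_funM => //; exact: measurable_cst.
- under eq_fun do rewrite ImM.
  by apply: measurable_funD; apply: measurable_funM => //; exact: measurable_cst.
Qed.

Lemma cmeasurableR (f : T -> R) : measurable_fun setT f ->
  cmeasurable (fun x => (f x)%:C).
Proof. by move=> mf; split => //=; exact: measurable_cst. Qed.

Lemma measurable_cmod f : cmeasurable f ->
  measurable_fun setT (fun x => cmod (f x)).
Proof.
move=> [fr fi]; under eq_fun do rewrite cmod_sqrt.
apply: (@measurableT_comp _ _ _ _ _ _ (@Num.sqrt R)).
  exact: continuous_measurable_fun (@sqrt_continuous R).
by apply: measurable_funD; apply: measurable_funX.
Qed.

Lemma measurable_EFin_cmod_powR f q : cmeasurable f ->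
  measurable_fun setT (fun x => (cmod (f x) `^ q)%:E).
Proof.
move=> mf; apply/measurable_EFinP.
by apply: (@measurableT_comp _ _ _ _ _ _ (@powR R ^~ q)) => //; exact: measurable_cmod.
Qed.

End cmeasurable.

(** * Norm bounds in [L^q] *)

Section norm_le.
Context {R : realType} {d : measure_display} {T : measurableType d}.
Variable mu : {measure set T -> \bar R}.
Implicit Types (f g : T -> R[i]) (q r s : R).

(** The bound is a finite real number: all estimates stay in [R], and membership
in [L^q] becomes the existence of a bound. *)
Definition norm_le q f r : Prop := (cLnorm mu q%:E f <= r%:E)%E.

Lemma norm_leP q f r : 0 < q -> 0 <= r ->
  norm_le q f r <-> (\int[mu]_x (cmod (f x) `^ q)%:E <= (r `^ q)%:E)%E.
Proof.
move=> q0 r0; rewrite /norm_le /cLnorm.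
have -> : (\int[mu]_x (cmod (f x) `^ q)%:E)%E =
    ((Lnorm mu q%:E (fun x => (cmod (f x))%:E)) `^ q)%E.
  rewrite poweR_Lnorm ?gt_eqF//; apply: eq_integral => x _ /=.
  by rewrite ger0_norm// cmod_ge0.
have homo (u v : \bar R) (t : R) : 0 < t -> (0 <= u -> 0 <= v -> u <= v -> u `^ t <= v `^ t)%E.
  by move=> t0 u0 v0; apply: gt0_ler_poweR; rewrite ?ltW// in_itv/= ?u0 ?v0 leey.
rewrite -poweR_EFin; split => [|le_r].
  by apply: homo; rewrite ?Lnorm_ge0 ?lee_fin.
have := homo _ _ q^-1 _ (poweR_ge0 _ _) (poweR_ge0 _ _) le_r.
rewrite invr_gt0 -!poweRrM divff ?gt_eqF// !poweRe1 ?Lnorm_ge0 ?lee_fin//.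
exact.
Qed.

Lemma norm_le_ge0 q f r : norm_le q f r -> 0 <= r.
Proof. by move=> fr; rewrite -lee_fin (le_trans _ fr)// Lnorm_ge0. Qed.

Lemma norm_leW q f r s : r <= s -> norm_le q f r -> norm_le q f s.
Proof. by move=> rs fr; apply: le_trans fr _; rewrite lee_fin. Qed.

Lemma cLnorm_lty q f : (cLnorm mu q%:E f < +oo)%E <-> exists r, norm_le q f r.
Proof.
split=> [fy|[r fr]]; last by rewrite (le_lt_trans fr)// ltry.
exists (fine (cLnorm mu q%:E f)); rewrite /norm_le fineK// ge0_fin_numE//.
exact: Lnorm_ge0.
Qed.

Lemma norm_le_ae q f g r : 0 < q -> cmeasurable f -> cmeasurable g ->
  (\forall x \ae mu, cmod (f x) <= cmod (g x)) ->
  norm_le q g r -> norm_le q f r.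
Proof.
move=> q0 mf mg fg gr; have r0 := norm_le_ge0 gr.
apply/norm_leP => //; move/norm_leP : gr => /(_ q0 r0); apply: le_trans.
apply: ae_ge0_le_integral => //.
- by move=> x _; rewrite lee_fin powR_ge0.
- exact: measurable_EFin_cmod_powR.
- by move=> x _; rewrite lee_fin powR_ge0.
- exact: measurable_EFin_cmod_powR.
- apply: filterS fg => x fg _; rewrite lee_fin.
  by apply: ge0_ler_powR => //; rewrite ?nnegrE ?cmod_ge0// ltW.
Qed.

Lemma norm_le_aeq q f g r : 0 < q -> cmeasurable f -> cmeasurable g ->
  (\forall x \ae mu, f x = g x) -> norm_le q g r -> norm_le q f r.
Proof.
move=> q0 mf mg fg; apply: norm_le_ae => //.
by apply: filterS fg => x ->.
Qed.

Lemma norm_leD q f g r s : 1 <= q -> cmeasurable f -> cmeasurable g ->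
  norm_le q f r -> norm_le q g s -> norm_le q (fun x => f x + g x) (r + s).
Proof.
move=> q1 mf mg fr gs; have q0 : 0 < q by rewrite (lt_le_trans ltr01).
apply: (@norm_le_ae _ _ (fun x => (cmod (f x) + cmod (g x))%:C)) => //.
- exact: cmeasurableD.
- by apply: cmeasurableR; apply: measurable_funD; exact: measurable_cmod.
- by apply: aeW => x; rewrite cmodR ?cmodD// addr_ge0 ?cmod_ge0.
rewrite /norm_le /cLnorm.
under eq_Lnorm do rewrite cmodR ?addr_ge0 ?cmod_ge0//.
rewrite EFinD; apply: le_trans (leeD fr gs).
by apply: (@minkowski_EFin _ _ _ mu (fun x => cmod (f x)) (fun x => cmod (g x))) => //; exact: measurable_cmod.
Qed.

Lemma norm_leN q f r : norm_le q f r -> norm_le q (fun x => - f x) r.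
Proof. by rewrite /norm_le /cLnorm; under [in X in _ -> X]eq_Lnorm do rewrite cmodN. Qed.

Lemma norm_leB q f g r s : 1 <= q -> cmeasurable f -> cmeasurable g ->
  norm_le q f r -> norm_le q g s -> norm_le q (fun x => f x - g x) (r + s).
Proof.
move=> q1 mf mg fr gs; apply: norm_leD => //; last exact: norm_leN.
by case: mg => mr mi; split; [under eq_fun do rewrite ReN|under eq_fun do rewrite ImN];
  exact: measurable_funN.
Qed.

Lemma norm_le_distC q f g r :
  norm_le q (fun x => f x - g x) r -> norm_le q (fun x => g x - f x) r.
Proof. by move/norm_leN; congr norm_le; apply/funext => x; rewrite opprB. Qed.

Lemma norm_leZ q k f r : 0 < q -> cmeasurable f ->
  norm_le q f r -> norm_le q (fun x => k * f x) (cmod k * r).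
Proof.
move=> q0 mf fr; have r0 := norm_le_ge0 fr; move/norm_leP : fr => /(_ q0 r0) fr.
apply/norm_leP => //; first by rewrite mulr_ge0 ?cmod_ge0.
under eq_integral do rewrite cmodM powRM ?cmod_ge0// EFinM.
rewrite ge0_integralZl//.
- by rewrite powRM ?cmod_ge0// EFinM lee_wpmul2l// lee_fin powR_ge0.
- exact: measurable_EFin_cmod_powR.
- by move=> x _; rewrite lee_fin powR_ge0.
- by rewrite lee_fin powR_ge0.
Qed.

Lemma norm_le_triangle q f g k r s : 1 <= q ->
  cmeasurable f -> cmeasurable g -> cmeasurable k ->
  norm_le q (fun x => f x - g x) r -> norm_le q (fun x => g x - k x) s ->
  norm_le q (fun x => f x - k x) (r + s).
Proof.
move=> q1 mf mg mk fg gk.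
rewrite (_ : (fun x => f x - k x) = (fun x => (f x - g x) + (g x - k x))).
  by apply: norm_leD => //; exact: cmeasurableB.
by apply/funext => x; rewrite addrA subrK.
Qed.

Lemma norm_le_subrr q f : 0 < q -> norm_le q (fun x => f x - f x) 0.
Proof.
move=> q0; apply/norm_leP => //; under eq_integral do rewrite subrr cmod0.
by rewrite powR0 ?gt_eqF// integral0.
Qed.

Lemma norm_le0_ae q f : 0 < q -> cmeasurable f ->
  (forall e, 0 < e -> norm_le q f e) -> \forall x \ae mu, f x = 0.
Proof.
move=> q0 mf fe.
have f0 : cLnorm mu q%:E f = 0%E.
  apply/eqP; rewrite eq_le Lnorm_ge0 andbT; apply/lee_addgt0Pr => e e0.
  by rewrite add0e; exact: fe.
have mcf : measurable_fun setT (fun x => (cmod (f x))%:E).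
  by apply/measurable_EFinP; exact: measurable_cmod.
have := Lnorm_eq0_eq0 mcf _ f0; rewrite lte_fin => /(_ q0).
by apply: filterS => x /(_ I) -[] /ComplexField.Normc.eq0_normc.
Qed.

End norm_le.

(** * Lower semicontinuity and completeness *)

Section powR_lipschitz.
Context {R : realType}.
Implicit Types a b p : R.

(** For [b <= a], Young's inequality applied to [b] and [a^(p-1)] says that
[t |-> t^p] lies above its tangent at [a], which gives the difference quotient
without differentiating. *)
Lemma powR_dist a b p : 1 < p -> 0 <= a -> 0 <= b ->
  `|a `^ p - b `^ p| <= p * (a + b) `^ (p - 1) * `|a - b|.
Proof.
move=> p1; have p0 : 0 < p by apply: lt_trans p1.
wlog ba : a b / b <= a.
  move=> H a0 b0; have [|/ltW] := leP b a; first by move=> /H; exact.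
  by move=> /H; rewrite distrC (distrC b) (addrC b); exact.
move=> a0 b0; have p'0 : 0 < p - 1 by rewrite subr_gt0.
have ab : b `^ p <= a `^ p by apply: ge0_ler_powR; rewrite ?nnegrE// ltW.
rewrite (ger0_norm (_ : 0 <= a `^ p - b `^ p)) ?subr_ge0//.
rewrite (ger0_norm (_ : 0 <= a - b)) ?subr_ge0//.
apply: (@le_trans _ _ (p * a `^ (p - 1) * (a - b))); last first.
  rewrite ler_wpM2r ?subr_ge0// ler_wpM2l ?(ltW p0)//.
  by apply: ge0_ler_powR; rewrite ?(ltW p'0)// ?nnegrE ?addr_ge0 ?lerDl.
have pq : p^-1 + (p / (p - 1))^-1 = 1.
  by rewrite invf_div; field; rewrite gt_eqF.
have q0 : 0 < p / (p - 1) by rewrite divr_gt0.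
have := conjugate_powR b0 (powR_ge0 a (p - 1)) p0 q0 pq.
rewrite -powRrM [(p - 1) * _]mulrC divfK ?gt_eqF// => H.
have {H} : p * (b * a `^ (p - 1)) <= b `^ p + (p - 1) * a `^ p.
  apply: le_trans (ler_wpM2l (ltW p0) H) _.
  rewrite le_eqVlt; apply/orP; left; apply/eqP; field.
  by rewrite !gt_eqF.
rewrite -[in X in _ -> _ <= X]mulrA mulrBr (mulrC _ a) mulr_powRB1//.
by rewrite (mulrC (a `^ _) b); lra.
Qed.

Lemma cvg_powR (u : nat -> R) (l p : R) : 1 < p -> (forall n, 0 <= u n) -> 0 <= l ->
  u n @[n --> \oo] --> l -> u n `^ p @[n --> \oo] --> l `^ p.
Proof.
move=> p1 u0 l0 ul; have p0 : 0 < p by apply: lt_trans p1.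
have p'0 : 0 < p - 1 by rewrite subr_gt0.
have ulM : \forall n \near \oo, u n <= l + 1.
  by apply: (cvgr_le l) => //; rewrite ltrDl.
have d0 : (p * (l + 1 + l) `^ (p - 1)) * `|u n - l| @[n --> \oo] --> 0.
  rewrite -[X in _ --> X](mulr0 (p * (l + 1 + l) `^ (p - 1))).
  apply: cvgMr; rewrite -[X in _ --> X](@normr0 _ R); apply: cvg_norm.
  by rewrite -(subrr l); apply: cvgB => //; exact: cvg_cst.
suff /norm_cvg0 H : `|u n `^ p - l `^ p| @[n --> \oo] --> (0 : R).
  exact: cvg_sub0 H (cvg_cst (l `^ p)).
apply: (squeeze_cvgr _ (cvg_cst 0) d0); near=> n; rewrite normr_ge0/=.
apply: le_trans (powR_dist p1 (u0 n) l0) _.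
rewrite ler_wpM2r// ler_wpM2l ?(ltW p0)//.
apply: ge0_ler_powR; rewrite ?(ltW p'0)// ?nnegrE ?addr_ge0// lerD2r.
by near: n.
Unshelve. all: by end_near. Qed.

End powR_lipschitz.

Section completeness.
Context {R : realType} {d : measure_display} {T : measurableType d}.
Variable mu : {measure set T -> \bar R}.
Implicit Types (f g : T -> R[i]) (q r s : R).

(** Fatou's lemma for the functions [|f_n|^q]: norm bounds pass to almost
everywhere limits, also when the norms do not converge. *)
Lemma norm_le_cvg q (f_ : nat -> T -> R[i]) f r : 1 < q ->
  (forall n, cmeasurable (f_ n)) -> cmeasurable f ->
  (\forall x \ae mu, cmod (f_ n x) @[n --> \oo] --> cmod (f x)) ->
  (forall n, norm_le mu q (f_ n) r) -> norm_le mu q f r.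
Proof.
move=> q1 mf_ mf fx f_r; have q0 : 0 < q by apply: lt_trans q1.
have r0 := norm_le_ge0 (f_r 0%N).
pose h n x := (cmod (f_ n x) `^ q)%:E.
have h0 n x : (0 <= h n x)%E by rewrite lee_fin powR_ge0.
have mh n : measurable_fun setT (h n) by exact: measurable_EFin_cmod_powR.
apply/norm_leP => //.
apply: (@le_trans _ _ (\int[mu]_x limn_einf (h^~ x))%E).
  apply: ae_ge0_le_integral => //.
  - by move=> x _; rewrite lee_fin powR_ge0.
  - exact: measurable_EFin_cmod_powR.
  - move=> x _; rewrite limn_einf_lim; apply: lime_ge.
      exact: is_cvg_einfs.
    by apply: nearW => n; apply: le_ereal_inf_tmp => _ [m /= _ <-].
  - rewrite (_ : (fun _ => _) = \- (fun x => limn_esup (fun n => - h n x)%E))%E.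
      apply: measurableT_comp => //; apply: measurable_fun_limn_esup => n.
      exact: measurableT_comp.
    by apply/funext => x /=; rewrite -limn_einfN; congr (limn_einf _); apply/funext => n /=; rewrite opprK.
  - apply: filterS fx => x fx _.
    have hx : h n x @[n --> \oo] --> (cmod (f x) `^ q)%:E.
      by apply: cvg_EFin; [exact: nearW|apply: cvg_powR => // *; exact: cmod_ge0].
    by rewrite is_cvg_limn_einfE ?(cvg_lim _ hx)//; apply/cvg_ex; exists (cmod (f x) `^ q)%:E.
apply: le_trans (fatou _ _ _ _) _ => //.
rewrite limn_einf_lim; apply: lime_le; first exact: is_cvg_einfs.
apply: nearW => n; apply: (@le_trans _ _ (\int[mu]_x h n x)%E).
  by apply: ereal_inf_lbound; exists n => /=.
exact/norm_leP.
Qed.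

Lemma norm_le_telescope q (f_ : nat -> T -> R[i]) (R_ : nat -> R) : 1 <= q ->
  (forall n, cmeasurable (f_ n)) ->
  (forall n, norm_le mu q (fun x => f_ n.+1 x - f_ n x) (R_ n - R_ n.+1)) ->
  forall n k, norm_le mu q (fun x => f_ (n + k)%N x - f_ n x) (R_ n - R_ (n + k)%N).
Proof.
move=> q1 mf_ f_R n; elim=> [|k IH].
  by rewrite addn0 subrr; apply: norm_le_subrr; exact: lt_le_trans q1.
rewrite addnS (_ : R_ n - _ = (R_ (n + k)%N - R_ (n + k).+1) + (R_ n - R_ (n + k)%N)).
  exact: norm_le_triangle (f_R _) IH.
by ring.
Qed.

(** The partial sums of [|f_(k+1) - f_k|] have norm at most [R_0] by Minkowski's
inequality, hence by monotone convergence the [q]-th power of their supremum is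
integrable and in particular finite almost everywhere. *)
Lemma fast_cauchy_ae q (f_ : nat -> T -> R[i]) (R_ : nat -> R) : 1 <= q ->
  (forall n, cmeasurable (f_ n)) -> (forall n, 0 <= R_ n) ->
  (forall n, norm_le mu q (fun x => f_ n.+1 x - f_ n x) (R_ n - R_ n.+1)) ->
  \forall x \ae mu, cvgn (series (fun k => cmod (f_ k.+1 x - f_ k x))).
Proof.
move=> q1 mf_ R_0 f_R; have q0 : 0 < q by exact: lt_le_trans q1.
pose G n x := series (fun k => cmod (f_ k.+1 x - f_ k x)) n.
have Gnd x : nondecreasing_seq (fun n => G n x).
  by apply: nondecreasing_series => k _ _; exact: cmod_ge0.
have G0 n x : 0 <= G n x by apply: sumr_ge0 => k _; exact: cmod_ge0.
have mfk k : measurable_fun setT (fun x => cmod (f_ k.+1 x - f_ k x)).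
  by apply: measurable_cmod; exact: cmeasurableB.
have mG n : measurable_fun setT (G n) by apply: measurable_sum.
have GR n : norm_le mu q (fun x => (G n x)%:C) (R_ 0%N - R_ n).
  elim: n => [|n IH].
    rewrite subrr; apply/norm_leP => //.
    have Gx0 x : G 0 x = 0 by rewrite /G /series/= big_geq.
    under eq_integral do rewrite Gx0 cmodR//.
    by rewrite powR0 ?gt_eqF// integral0.
  rewrite (_ : R_ 0%N - _ = (R_ 0%N - R_ n) + (R_ n - R_ n.+1)); last by ring.
  rewrite (_ : (fun x => _) =
      (fun x => (G n x)%:C + (cmod (f_ n.+1 x - f_ n x))%:C)); last first.
    by apply/funext => x; rewrite /G -rmorphD; congr (_%:C); rewrite /series/= big_nat_recr.
  apply: norm_leD => //; try exact: cmeasurableR.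
  rewrite /norm_le /cLnorm; under eq_Lnorm do rewrite cmodR ?cmod_ge0//.
  exact: f_R.
pose h n x := (G n x `^ q)%:E.
have h0 n x : (0 <= h n x)%E by rewrite lee_fin powR_ge0.
have mh n : measurable_fun setT (h n).
  apply/measurable_EFinP.
  exact: (@measurableT_comp _ _ _ _ _ _ (@powR R ^~ q)).
have hnd x : nondecreasing_seq (h^~ x).
  move=> m n mn; rewrite lee_fin ge0_ler_powR ?nnegrE ?(ltW q0)//.
  exact: Gnd.
have hR n : (\int[mu]_x h n x <= (R_ 0%N `^ q)%:E)%E.
  have RB : R_ 0%N - R_ n <= R_ 0%N by rewrite gerBl.
  have /norm_leP := norm_leW RB (GR n); move=> /(_ q0 (R_0 0%N)); apply: le_trans.
  by rewrite le_eqVlt; apply/orP; left; apply/eqP/eq_integral => x _; rewrite cmodR.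
have mlim : measurable_fun setT (fun x => limn (h^~ x)).
  apply: (@emeasurable_fun_cvg _ _ _ _ h) => // x _.
  exact: ereal_nondecreasing_is_cvgn.
have lim_lty : (\int[mu]_x limn (h^~ x) < +oo)%E.
  rewrite monotone_convergence//; apply: (@le_lt_trans _ _ (R_ 0%N `^ q)%:E); last exact: ltry.
  apply: lime_le; last exact: nearW.
  apply: ereal_nondecreasing_is_cvgn => m n mn; apply: ge0_le_integral => //.
  by move=> x _; exact: hnd.
have lim_ge0 x : (0 <= limn (h^~ x))%E.
  by apply: lime_ge; [exact: ereal_nondecreasing_is_cvgn|exact: nearW].
have : mu.-integrable setT (fun x => limn (h^~ x)).
  apply/integrableP; split => //; under eq_integral do rewrite gee0_abs//.
  exact: lim_lty.
move=> /(integrable_ae measurableT); apply: filterS => x /(_ I) fx.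
apply: (nondecreasing_is_cvgn (Gnd x)).
exists (fine (limn (h^~ x)) `^ q^-1) => _ [n _ <-].
have -> : G n x = (G n x `^ q) `^ q^-1 by rewrite -powRrM divff ?gt_eqF// powRr1.
apply: ge0_ler_powR; rewrite ?invr_ge0 ?(ltW q0)// ?nnegrE ?powR_ge0 ?fine_ge0//.
rewrite -lee_fin fineK//; apply: lime_ge; first exact: ereal_nondecreasing_is_cvgn.
by exists n => // m /= nm; exact: hnd.
Qed.

Lemma cvg_of_cvg_increments (u : nat -> R) (v : nat -> R) :
  (forall k, `|u k.+1 - u k| <= v k) -> cvgn (series v) -> cvgn u.
Proof.
move=> uv cv.
have v0 n : 0 <= v n by exact: le_trans (uv n).
have cu : cvgn [normed series (fun k => u k.+1 - u k)].
  exact: (series_le_cvg (fun n => normr_ge0 _) v0 uv cv).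
have := normed_cvg cu; rewrite (_ : series _ = (fun n => u n - u 0%N)).
  move=> /cvg_ex[l ul]; apply/cvg_ex; exists (l + u 0%N).
  have := cvgD ul (cvg_cst (u 0%N)).
  rewrite (_ : _ + _ = u) => [|]; first exact.
  by apply/funext => n /=; rewrite /GRing.add/= subrK.
by apply/funext => n; rewrite /series/= telescope_sumr.
Qed.

(** Completeness with an explicit rate.  Bounding consecutive distances by
[R_n - R_(n+1)] makes the tails of the series telescope, so that [R_n] itself
bounds the distance to the limit. *)
Lemma riesz_fischer q (f_ : nat -> T -> R[i]) (R_ : nat -> R) : 1 < q ->
  (forall n, cmeasurable (f_ n)) -> (forall n, 0 <= R_ n) ->
  (forall n, norm_le mu q (fun x => f_ n.+1 x - f_ n x) (R_ n - R_ n.+1)) ->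
  exists f, [/\ cmeasurable f,
    forall n, norm_le mu q (fun x => f x - f_ n x) (R_ n)
    & \forall x \ae mu, cmod (f_ n x) @[n --> \oo] --> cmod (f x)].
Proof.
move=> q1 mf_ R_0 f_R; have q0 : 0 < q by exact: lt_trans q1.
have [N [mN N0 cvN]] := fast_cauchy_ae (ltW q1) mf_ R_0 f_R.
(* cutting off the null set makes the limit measurable everywhere *)
pose E := ~` N; have mE : measurable E by exact: measurableC.
have cvE x : E x -> cvgn (series (fun k => cmod (f_ k.+1 x - f_ k x))).
  by move=> Ex; apply: contrapT => ncv; apply: Ex; apply: cvN.
pose ur n x := \1_E x * complex.Re (f_ n x).
pose ui n x := \1_E x * complex.Im (f_ n x).
have mur n : measurable_fun setT (ur n).
  by apply: measurable_funM => //; exact: (mf_ n).1.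
have mui n : measurable_fun setT (ui n).
  by apply: measurable_funM => //; exact: (mf_ n).2.
have cur x : cvgn (ur^~ x).
  have [Ex|nEx] := pselect (E x); last first.
    by rewrite /ur indicE memNset//; under eq_fun do rewrite mul0r; exact: is_cvg_cst.
  apply: cvg_of_cvg_increments (cvE _ Ex) => k.
  by rewrite /ur indicE mem_set// !mul1r -ReN -ReD; exact: Re_le_cmod.
have cui x : cvgn (ui^~ x).
  have [Ex|nEx] := pselect (E x); last first.
    by rewrite /ui indicE memNset//; under eq_fun do rewrite mul0r; exact: is_cvg_cst.
  apply: cvg_of_cvg_increments (cvE _ Ex) => k.
  by rewrite /ui indicE mem_set// !mul1r -ImN -ImD; exact: Im_le_cmod.
pose f x := limn (ur^~ x) +i* limn (ui^~ x).
have mf : cmeasurable f.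
  split => /=; first by apply: (@measurable_fun_cvg _ _ _ _ ur) => // x _; exact: cur.
  by apply: (@measurable_fun_cvg _ _ _ _ ui) => // x _; exact: cui.
have fE x : E x -> complex.Re (f_ n x) @[n --> \oo] --> complex.Re (f x) /\
                   complex.Im (f_ n x) @[n --> \oo] --> complex.Im (f x).
  move=> Ex; have := cur x; have := cui x; rewrite /f /=.
  have -> : ur^~ x = (fun n => complex.Re (f_ n x)).
    by apply/funext => n; rewrite /ur indicE mem_set// mul1r.
  have -> : ui^~ x = (fun n => complex.Im (f_ n x)).
    by apply/funext => n; rewrite /ui indicE mem_set// mul1r.
  by split.
exists f; split => //.
- move=> n; apply: (@norm_le_cvg _ (fun k x => f_ (n + k)%N x - f_ n x)) => //.
  + by move=> k; exact: cmeasurableB.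
  + exact: cmeasurableB.
  + exists N; split => // x /= nx; apply: contrapT => Ex; apply: nx.
    have [fr fi] := fE _ Ex.
    apply: cvg_cmod; [under eq_fun do rewrite ReD ReN|under eq_fun do rewrite ImD ImN];
      rewrite ?ReD ?ReN ?ImD ?ImN.
    * apply: cvgB; last exact: cvg_cst.
      by under eq_fun do rewrite addnC; move: fr; rewrite -(cvg_shiftn n (fun k => complex.Re (f_ k x))).
    * apply: cvgB; last exact: cvg_cst.
      by under eq_fun do rewrite addnC; move: fi; rewrite -(cvg_shiftn n (fun k => complex.Im (f_ k x))).
  + move=> k; apply: norm_leW (norm_le_telescope (ltW q1) mf_ f_R n k).
    by rewrite gerBl.
- exists N; split => // x /= nx; apply: contrapT => Ex; apply: nx.
  have [fr fi] := fE _ Ex; exact: cvg_cmod fr fi.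
Qed.

End completeness.

(** * Boundedness of everywhere defined operators *)

Section bounded.
Context {R : realType} {d : measure_display} {T : measurableType d}.
Variable mu : {measure set T -> \bar R}.
Implicit Types (f g : T -> R[i]) (q r s : R).

Lemma half_lt_eps (c e : R) : 0 < e -> exists n, c * 2^-1 ^+ n <= e.
Proof.
move=> e0; have [c0|c0] := leP c 0.
  by exists 0%N; rewrite expr0 mulr1 (le_trans c0)// ltW.
have [n cn] : exists n : nat, c / e < n%:R.
  by exists (Num.bound (c / e)); exact: archi_boundP (divr_ge0 (ltW c0) (ltW e0)).
exists n; rewrite exprVn ler_pdivrMr ?exprn_gt0// mulrC -ler_pdivrMr//.
apply: le_trans (ltW cn) _; rewrite -natrX ler_nat.
by apply: ltnW; exact: ltn_expl.
Qed.

Lemma cLp_norm_le q f : cLp mu q%:E f -> exists r, norm_le mu q f r.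
Proof. by move=> [_ /cLnorm_lty]. Qed.

Lemma norm_le_cLp q f r : cmeasurable f -> norm_le mu q f r -> cLp mu q%:E f.
Proof. by move=> mf fr; split => //; apply/cLnorm_lty; exists r. Qed.

Lemma cLp_lin q k f g : 1 <= q -> cLp mu q%:E f -> cLp mu q%:E g ->
  cLp mu q%:E (fun x => k * f x + g x).
Proof.
move=> q1 /[dup] -[mf _] /cLp_norm_le[r fr] /[dup] -[mg _] /cLp_norm_le[s gs].
have q0 : 0 < q by exact: lt_le_trans q1.
apply: (@norm_le_cLp _ _ (cmod k * r + s)).
  by apply: cmeasurableD => //; exact: cmeasurableZ.
by apply: norm_leD => //; [exact: cmeasurableZ|exact: norm_leZ].
Qed.

Lemma cLp_near q f g r : 1 <= q -> cmeasurable f -> cLp mu q%:E g ->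
  norm_le mu q (fun x => f x - g x) r -> cLp mu q%:E f.
Proof.
move=> q1 mf /[dup] -[mg _] /cLp_norm_le[s gs] fg.
apply: (@norm_le_cLp _ _ (r + s)) => //.
rewrite (_ : f = (fun x => (f x - g x) + g x)).
  by apply: norm_leD => //; exact: cmeasurableB.
by apply/funext => x; rewrite subrK.
Qed.

Lemma cLpB q f g : 1 <= q -> cLp mu q%:E f -> cLp mu q%:E g ->
  cLp mu q%:E (fun x => f x - g x).
Proof.
move=> q1 Lf Lg; rewrite (_ : (fun _ => _) = (fun x => -1 * g x + f x)).
  exact: cLp_lin.
by apply/funext => x; rewrite mulN1r addrC.
Qed.

Variables (B : (T -> R[i]) -> T -> R[i]) (H q : R).
Hypothesis q1 : 1 < q.
Hypothesis B_lin : linear_on_L2 mu mu B.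
Hypothesis B_L2 : forall f, cLp mu 2%:E f -> cLp mu 2%:E (B f).
Hypothesis H0 : 0 < H.
Hypothesis B_bounded : forall f r, cLp mu 2%:E f ->
  norm_le mu 2 f r -> norm_le mu 2 (B f) (H * r).

Let one_lt2 : (1 : R) < 2. Proof. by rewrite ltr1n. Qed.
Let one_le2 : (1 : R) <= 2. Proof. by rewrite ler1n. Qed.
Let gt02 : (0 : R) < 2. Proof. by []. Qed.

Lemma linear_on_L2B f g : cLp mu 2%:E f -> cLp mu 2%:E g ->
  \forall x \ae mu, B (fun x => f x - g x) x = B f x - B g x.
Proof.
move=> Lf Lg; have := B_lin (-1) Lg Lf.
rewrite (_ : (fun x => -1 * g x + f x) = (fun x => f x - g x)); last first.
  by apply/funext => x; rewrite mulN1r addrC.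
by apply: filterS => x ->; rewrite mulN1r addrC.
Qed.

Lemma bounded_dist f g r : cLp mu 2%:E f -> cLp mu 2%:E g ->
  norm_le mu 2 (fun x => f x - g x) r ->
  norm_le mu 2 (fun x => B f x - B g x) (H * r).
Proof.
move=> Lf Lg fg; have Lfg := cLpB one_le2 Lf Lg.
apply: norm_le_aeq (B_bounded Lfg fg) => //.
- by apply: cmeasurableB; exact: (B_L2 _).1.
- exact: (B_L2 _).1.
- by apply: filterS (linear_on_L2B Lf Lg) => x ->.
Qed.

(** If [z_n] tends to [y] fast, then so does [B z_n] to [B y] in [L^2], hence
almost everywhere, and Fatou's lemma applies in [L^q].  Thus the sets where
[|B y|_q <= K] are closed in [L^2]. *)
Lemma image_norm_lsc y K : cLp mu 2%:E y ->
  (forall e, 0 < e -> exists z, [/\ cLp mu 2%:E z,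
     norm_le mu 2 (fun x => z x - y x) e & norm_le mu q (B z) K]) ->
  norm_le mu q (B y) K.
Proof.
move=> Ly yz; pose e_ n : R := 2^-1 ^+ n.
have e0 n : 0 < e_ n by rewrite exprn_gt0// invr_gt0.
have eS n : e_ n.+1 = e_ n / 2 by rewrite /e_ exprS mulrC.
have /choice[z zP] n := yz (e_ n) (e0 n).
have zL n : cLp mu 2%:E (z n) by have [] := zP n.
have zy n : norm_le mu 2 (fun x => z n x - y x) (e_ n) by have [] := zP n.
have zK n : norm_le mu q (B (z n)) K by have [] := zP n.
have mBz n : cmeasurable (B (z n)) by exact: (B_L2 _).1.
have mBy : cmeasurable (B y) by exact: (B_L2 _).1.
have Bzy n : norm_le mu 2 (fun x => B (z n) x - B y x) (H * e_ n).
  exact: bounded_dist.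
have [f [mf fz fcvg]] : exists f, [/\ cmeasurable f,
    forall n, norm_le mu 2 (fun x => f x - B (z n) x) (4 * H * e_ n)
    & \forall x \ae mu, cmod (B (z n) x) @[n --> \oo] --> cmod (f x)].
  apply: riesz_fischer => // n.
    by rewrite !mulr_ge0// ltW.
  apply: norm_leW (norm_le_triangle _ _ _ _ (Bzy n.+1) (norm_le_distC (Bzy n))) => //.
  rewrite eS; have := mulr_gt0 H0 (e0 n); lra.
have fK : norm_le mu q f K by apply: (norm_le_cvg q1 _ mf fcvg).
apply: norm_le_aeq fK => //; first exact: lt_trans q1.
have mfB : cmeasurable (fun x => f x - B y x) by exact: cmeasurableB.
have : \forall x \ae mu, f x - B y x = 0.
  apply: (@norm_le0_ae _ _ _ mu _ _ gt02 mfB) => e e0'; have [n ne] := half_lt_eps (5 * H) e0'.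
  apply: norm_leW (norm_le_triangle _ _ _ _ (fz n) (Bzy n)) => //.
  by apply: le_trans ne; rewrite -/(e_ n); lra.
by apply: filterS => x /eqP; rewrite subr_eq0 => /eqP.
Qed.

Lemma norm_le_scale_inv (k : R) f r : 0 < k -> cmeasurable f ->
  norm_le mu q (fun x => k%:C * f x) r -> norm_le mu q f (r / k).
Proof.
move=> k0 mf kf.
rewrite (_ : f = (fun x => (k^-1)%:C * (k%:C * f x))).
  rewrite (_ : r / k = cmod (k^-1)%:C * r); last by rewrite cmodR ?invr_ge0 ?ltW// mulrC.
  by apply: norm_leZ => //; [exact: lt_trans q1|exact: cmeasurableZ].
by apply/funext => x; rewrite mulrA -rmorphM mulVf ?gt_eqF// mul1r.
Qed.

Hypothesis B_Lq : forall f, cLp mu 2%:E f -> cLp mu q%:E (B f).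

(** As [2 r (B g)] is the difference of the images of [x + r g] and [x - r g], one
of these two points near [x] has a large image as soon as [B g] is large: the
complements of the closed sets above are dense if [B] is unbounded. *)
Lemma large_image_near g x r K : 0 < r -> cLp mu 2%:E g -> cLp mu 2%:E x ->
  norm_le mu 2 g 1 -> ~ norm_le mu q (B g) (K / r) ->
  exists y, [/\ cLp mu 2%:E y, norm_le mu 2 (fun t => y t - x t) r
    & ~ norm_le mu q (B y) K].
Proof.
move=> r0 Lg Lx g1 NBg; have q0 : 0 < q by exact: lt_trans q1.
have near (k : R[i]) : cmod k = r ->
    norm_le mu 2 (fun t => (k * g t + x t) - x t) r.
  move=> kr; rewrite (_ : (fun t => _) = (fun t => k * g t)); last first.
    by apply/funext => t; rewrite addrK.
  by rewrite -[r]mulr1 -kr; apply: norm_leZ => //; exact: Lg.1.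
have Lk (k : R[i]) : cLp mu 2%:E (fun t => k * g t + x t) by exact: cLp_lin.
have c1 : cmod r%:C = r by rewrite cmodR// ltW.
have c2 : cmod (- r%:C) = r by rewrite cmodN.
have [N1|N1] := pselect (norm_le mu q (B (fun t => r%:C * g t + x t)) K); last first.
  by exists (fun t => r%:C * g t + x t); split => //; exact: near.
have [N2|N2] := pselect (norm_le mu q (B (fun t => - r%:C * g t + x t)) K); last first.
  by exists (fun t => - r%:C * g t + x t); split => //; exact: near.
exfalso; apply: NBg.
have mB f : cLp mu 2%:E f -> cmeasurable (B f) by move=> /B_L2[].
have K2 : K / r = (K + K) / (r + r).
  by field; rewrite !gt_eqF ?addr_gt0.
rewrite K2; apply: norm_le_scale_inv; [exact: addr_gt0|exact: mB|].
apply: norm_le_aeq (norm_leB (ltW q1) (mB _ (Lk _)) (mB _ (Lk _)) N1 N2) => //.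
- exact/cmeasurableZ/mB.
- by apply: cmeasurableB; exact: mB.
apply: filterS2 (B_lin r%:C Lg Lx) (B_lin (- r%:C) Lg Lx) => t -> ->.
by rewrite rmorphD/=; ring.
Qed.

(** The closed graph theorem for [B], by Baire's argument.  The bound is asked for
every [r > 0] above the norm of [f] and not for the norm itself, so that no
special case is needed when [f] vanishes almost everywhere. *)
Lemma L2_Lq_bounded : exists2 C : R, 0 < C &
  forall f r, 0 < r -> cLp mu 2%:E f -> norm_le mu 2 f r ->
    norm_le mu q (B f) (C * r).
Proof.
have q0 : 0 < q by exact: lt_trans q1.
suff [C CP] : exists C : R, forall g, cLp mu 2%:E g -> norm_le mu 2 g 1 ->
    norm_le mu q (B g) C.
  exists (`|C| + 1); first by rewrite ltr_pwDr.
  move=> f r r0 Lf fr; pose g t := (r^-1)%:C * f t + (0 * f t).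
  have gE : g = (fun t => (r^-1)%:C * f t).
    by apply/funext => t; rewrite /g mul0r addr0.
  have L0 : cLp mu 2%:E (fun t => 0 * f t).
    rewrite (_ : (fun t => _) = (fun t => -1 * f t + f t)); first exact: cLp_lin.
    by apply/funext => t; rewrite mul0r mulN1r addNr.
  have Lg : cLp mu 2%:E g by exact: cLp_lin.
  have fE : (fun t => r%:C * g t + 0 * f t) = f.
    apply/funext => t; rewrite gE mulrA -rmorphM mulfV ?gt_eqF//.
    by rewrite mul1r mul0r addr0.
  have L00 : (fun t => 1 * (0 * f t) + (0 * f t)) = (fun t => 0 * f t).
    by apply/funext => t; rewrite !mul0r addr0 mulr0.
  have g1 : norm_le mu 2 g 1.
    rewrite gE; have := norm_leZ (r^-1)%:C gt02 Lf.1 fr.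
    by rewrite cmodR ?invr_ge0 ?ltW// mulVf ?gt_eqF.
  have Bg : norm_le mu q (fun t => r%:C * B g t) (cmod r%:C * C).
    by apply: norm_leZ => //; [exact: (B_L2 _).1|exact: CP].
  have {}Bg : norm_le mu q (fun t => r%:C * B g t) ((`|C| + 1) * r).
    apply: norm_leW Bg; rewrite cmodR ?(ltW r0)// mulrC ler_wpM2r ?(ltW r0)//.
    by rewrite (le_trans (ler_norm C))// lerDl.
  apply: norm_le_aeq Bg => //.
  - exact: (B_L2 _).1.
  - by apply: cmeasurableZ; exact: (B_L2 _).1.
  apply: filterS2 (B_lin r%:C Lg L0) (B_lin 1 L0 L0) => t.
  rewrite fE L00 => -> /eqP; rewrite mul1r addrC -subr_eq subrr eq_sym => /eqP ->.
  by rewrite addr0.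
apply: contrapT => unbounded.
have unb (C : R) : exists g, [/\ cLp mu 2%:E g, norm_le mu 2 g 1
    & ~ norm_le mu q (B g) C].
  apply: contrapT => NC; apply: unbounded; exists C => g Lg g1.
  by apply: contrapT => NB; apply: NC; exists g.
(* a state is a ball, given by its centre and radius; each ball lies in the
   preceding one and its points have images of norm more than the stage *)
have step (s : nat * ((T -> R[i]) * R)) : exists s' : (T -> R[i]) * R,
    cLp mu 2%:E s.2.1 -> 0 < s.2.2 ->
    [/\ cLp mu 2%:E s'.1, 0 < s'.2, s'.2 <= s.2.2 / 2,
        norm_le mu 2 (fun t => s'.1 t - s.2.1 t) (s.2.2 / 2)
      & forall z, cLp mu 2%:E z -> norm_le mu 2 (fun t => z t - s'.1 t) s'.2 ->
          ~ norm_le mu q (B z) s.1%:R].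
  case: s => n [x r] /=.
  have [Lx|] := pselect (cLp mu 2%:E x); last by exists (x, r).
  have [r0|] := ltP 0 r; last by exists (x, r).
  have r20 : 0 < r / 2 by rewrite divr_gt0.
  have [g [Lg g1 NBg]] := unb (n%:R / (r / 2)).
  have [y [Ly yx NBy]] := large_image_near r20 Lg Lx g1 NBg.
  have [e [e0 eP]] : exists e, 0 < e /\ forall z, cLp mu 2%:E z ->
      norm_le mu 2 (fun t => z t - y t) e -> ~ norm_le mu q (B z) n%:R.
    apply: contrapT => Ne; apply: NBy; apply: image_norm_lsc => // e e0.
    apply: contrapT => Nz; apply: Ne; exists e; split => // z Lz zy Bz.
    by apply: Nz; exists z.
  exists (y, Num.min e (r / 2)) => _ _; split => //=.
  - by rewrite lt_min e0.
  - by rewrite ge_min lexx orbT.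
  - by move=> z Lz zy; apply: eP => //; apply: norm_leW zy; rewrite ge_min lexx.
have /choice[S SP] := step.
have [g0 [Lg0 _ _]] := unb 0.
pose st := fix st n := if n is n'.+1 then S (n', st n') else (g0, 1).
have stP n : cLp mu 2%:E (st n).1 /\ 0 < (st n).2.
  elim: n => [|n [IL Ir]]; first by split => //=; exact: ltr01.
  by have [] := SP (n, st n) IL Ir.
have stS n : [/\ (st n.+1).2 <= (st n).2 / 2,
        norm_le mu 2 (fun t => (st n.+1).1 t - (st n).1 t) ((st n).2 / 2)
      & forall z, cLp mu 2%:E z ->
          norm_le mu 2 (fun t => z t - (st n.+1).1 t) (st n.+1).2 ->
          ~ norm_le mu q (B z) n%:R].
  by have [IL Ir] := stP n; have [] := SP (n, st n) IL Ir.
(* the point common to all balls *)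
have [x [mx xst _]] : exists f, [/\ cmeasurable f,
    forall n, norm_le mu 2 (fun t => f t - (st n).1 t) ((st n).2)
    & \forall t \ae mu, cmod ((st n).1 t) @[n --> \oo] --> cmod (f t)].
  apply: riesz_fischer => // n.
  - exact: (stP n).1.1.
  - exact: ltW (stP n).2.
  - by have [le_half + _] := stS n; apply: norm_leW; lra.
have Lx : cLp mu 2%:E x := cLp_near one_le2 mx (stP 0%N).1 (xst 0%N).
have [r Bxr] := cLp_norm_le (B_Lq Lx).
have rn : r <= (Num.bound r)%:R by rewrite ltW// archi_boundP// (norm_le_ge0 Bxr).
have [_ _ /(_ x Lx (xst _))] := stS (Num.bound r).
by apply; exact: norm_leW Bxr.
Qed.

End bounded.

(** * The nonlinearity *)

Section nonlinearity.
Context {R : realType} {d : measure_display} {T : measurableType d}.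
Variable mu : {measure set T -> \bar R}.
Implicit Types (f g : T -> R[i]) (p r s : R).

Lemma measurable_cmod_powR p f : cmeasurable f ->
  measurable_fun setT (fun x => cmod (f x) `^ p).
Proof. by move=> mf; apply/measurable_EFinP; exact: measurable_EFin_cmod_powR. Qed.

Lemma norm_le_cmod_powR p f r : 1 < p -> cmeasurable f ->
  norm_le mu (2 * p) f r -> norm_le mu 2 (fun x => (cmod (f x) `^ p)%:C) (r `^ p).
Proof.
move=> p1 mf fr; have p0 : 0 < p by exact: lt_trans p1.
have r0 := norm_le_ge0 fr.
apply/norm_leP; rewrite ?powR_ge0// -powRrM (mulrC p).
move/norm_leP : fr => /(_ _ r0); rewrite mulr_gt0// => /(_ isT); apply: le_trans.
rewrite le_eqVlt; apply/orP; left; apply/eqP/eq_integral => x _.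
by rewrite cmodR ?powR_ge0// -powRrM (mulrC p).
Qed.

(** Hoelder's inequality with exponents [p] and [p / (p - 1)] for [|f|^2] and
[|g|^(2(p-1))], in normalised form: Young's inequality is integrated, and the
two terms on the right carry weights of sum [1]. *)
Lemma norm_le_prod p f g : 1 < p -> cmeasurable f -> cmeasurable g ->
  norm_le mu (2 * p) f 1 -> norm_le mu (2 * p) g 1 ->
  norm_le mu 2 (fun x => (cmod (f x) * cmod (g x) `^ (p - 1))%:C) 1.
Proof.
move=> p1 mf mg; have p0 : 0 < p by exact: lt_trans p1.
have p'0 : 0 < p - 1 by rewrite subr_gt0.
have pp : 0 < 2 * p by rewrite mulr_gt0.
move=> /norm_leP => /(_ pp ler01) f1 /norm_leP => /(_ pp ler01) g1.
apply/norm_leP => //; rewrite powR1 in f1 g1 *.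
have pq : p^-1 + (p / (p - 1))^-1 = 1.
  by rewrite invf_div; field; rewrite gt_eqF.
have q0 : 0 < p / (p - 1) by rewrite divr_gt0.
apply: (@le_trans _ _ (\int[mu]_x ((p^-1)%:E * (cmod (f x) `^ (2 * p))%:E +
    ((p / (p - 1))^-1)%:E * (cmod (g x) `^ (2 * p))%:E))%E).
  apply: ge0_le_integral => //.
  - by move=> x _; rewrite lee_fin powR_ge0.
  - apply: measurable_EFin_cmod_powR; apply: cmeasurableR.
    by apply: measurable_funM; [exact: measurable_cmod|exact: measurable_cmod_powR].
  - by apply: emeasurable_funD; apply: emeasurable_funM => //;
      exact: measurable_EFin_cmod_powR.
  - move=> x _; rewrite -!EFinM -EFinD lee_fin cmodR; last first.
      by rewrite mulr_ge0 ?cmod_ge0 ?powR_ge0.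
    rewrite powRM ?cmod_ge0 ?powR_ge0// -powRrM.
    apply: le_trans (conjugate_powR (powR_ge0 _ _) (powR_ge0 _ _) p0 q0 pq) _.
    rewrite -!powRrM (_ : (p - 1) * 2 * (p / (p - 1)) = 2 * p); last first.
      by field; rewrite gt_eqF.
    by rewrite mulrC (mulrC (cmod (g x) `^ _)).
rewrite ge0_integralD//; last 4 first.
- by move=> x _; rewrite -EFinM lee_fin mulr_ge0 ?powR_ge0// invr_ge0 ltW.
- by apply: emeasurable_funM => //; exact: measurable_EFin_cmod_powR.
- by move=> x _; rewrite -EFinM lee_fin mulr_ge0 ?powR_ge0// invr_ge0 ltW.
- by apply: emeasurable_funM => //; exact: measurable_EFin_cmod_powR.
rewrite !ge0_integralZl//; try exact: measurable_EFin_cmod_powR;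
  try (by move=> x _; rewrite lee_fin powR_ge0); try by rewrite lee_fin invr_ge0 ltW.
rewrite -[leRHS](_ : ((p^-1)%:E * 1 + ((p / (p - 1))^-1)%:E * 1)%E = 1%:E); last first.
  by rewrite !mule1 -EFinD pq.
by apply: leeD; rewrite lee_pmul2l// lte_fin invr_gt0.
Qed.

(** [powR_dist] bounds the left-hand side by [p (|f| + |g|)^(p-1) |f - g|]; both
factors are scaled to norm [1] before [norm_le_prod] is applied. *)
Lemma norm_le_powR_dist p f g r s : 1 < p -> cmeasurable f -> cmeasurable g ->
  0 < r -> 0 < s -> norm_le mu (2 * p) f s -> norm_le mu (2 * p) g s ->
  norm_le mu (2 * p) (fun x => f x - g x) r ->
  norm_le mu 2 (fun x => (cmod (f x) `^ p)%:C - (cmod (g x) `^ p)%:C)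
    (p * (2 * s) `^ (p - 1) * r).
Proof.
move=> p1 mf mg r0 s0 fs gs fg; have p0 : 0 < p by exact: lt_trans p1.
have p'0 : 0 < p - 1 by rewrite subr_gt0.
have pp : 0 < 2 * p by rewrite mulr_gt0.
have pp1 : 1 <= 2 * p.
  by rewrite (le_trans (ltW p1))// ler_peMl ?ler1n// ltW.
have ss0 : 0 < 2 * s by rewrite mulr_gt0.
have mS : cmeasurable (fun x => (cmod (f x) + cmod (g x))%:C).
  by apply: cmeasurableR; apply: measurable_funD; exact: measurable_cmod.
have mD : cmeasurable (fun x => f x - g x) by exact: cmeasurableB.
pose D x := (r^-1)%:C * (f x - g x).
pose S x := ((2 * s)^-1)%:C * (cmod (f x) + cmod (g x))%:C.
have D1 : norm_le mu (2 * p) D 1.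
  have := norm_leZ (r^-1)%:C pp mD fg.
  by rewrite cmodR ?invr_ge0 ?(ltW r0)// mulVf ?gt_eqF.
have S1 : norm_le mu (2 * p) S 1.
  have cs h : norm_le mu (2 * p) h s -> norm_le mu (2 * p) (fun x => (cmod (h x))%:C) s.
    rewrite /norm_le /cLnorm; under [in X in _ -> X]eq_Lnorm do rewrite cmodR ?cmod_ge0//.
    exact.
  have Ss : norm_le mu (2 * p) (fun x => (cmod (f x) + cmod (g x))%:C) (2 * s).
    rewrite (_ : (fun x => _) = (fun x => (cmod (f x))%:C + (cmod (g x))%:C)); last first.
      by apply/funext => x; rewrite rmorphD.
    have -> : 2 * s = s + s by ring.
    apply: norm_leD => //;
      by [apply: cmeasurableR; exact: measurable_cmod|exact: cs].
  have := norm_leZ ((2 * s)^-1)%:C pp mS Ss.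
  by rewrite cmodR ?invr_ge0 ?(ltW ss0)// mulVf ?gt_eqF.
have mDD : cmeasurable D by exact: cmeasurableZ.
have mSS : cmeasurable S by exact: cmeasurableZ.
have DS := norm_le_prod p1 mDD mSS D1 S1.
set K := p * _ * r.
have K0 : 0 <= K by rewrite !mulr_ge0 ?powR_ge0// ltW.
have mP : cmeasurable (fun x => (cmod (D x) * cmod (S x) `^ (p - 1))%:C).
  apply: cmeasurableR.
  by apply: measurable_funM; [exact: measurable_cmod|exact: measurable_cmod_powR].
have gt02 : (0 : R) < 2 by [].
have := norm_leZ K%:C gt02 mP DS; rewrite cmodR// mulr1.
apply: norm_le_ae => //.
- by apply: cmeasurableB; apply: cmeasurableR; exact: measurable_cmod_powR.
- exact: cmeasurableZ.
apply: aeW => x; rewrite -rmorphB cmodR_norm cmodM cmodR//.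
rewrite cmodR ?mulr_ge0 ?cmod_ge0 ?powR_ge0//.
apply: le_trans (powR_dist p1 (cmod_ge0 _) (cmod_ge0 _)) _.
rewrite /D /S !cmodM !cmodR ?invr_ge0 ?(ltW r0) ?(ltW ss0) ?addr_ge0 ?cmod_ge0//.
rewrite powRM ?invr_ge0 ?(ltW ss0) ?addr_ge0 ?cmod_ge0//.
have -> : K * (r^-1 * cmod (f x - g x) * ((2 * s)^-1 `^ (p - 1) *
    (cmod (f x) + cmod (g x)) `^ (p - 1))) =
    ((2 * s) * (2 * s)^-1) `^ (p - 1) * (r * r^-1) *
    (p * (cmod (f x) + cmod (g x)) `^ (p - 1) * cmod (f x - g x)).
  by rewrite powRM ?invr_ge0 ?(ltW ss0)// /K; ring.
rewrite !mulfV ?gt_eqF// powR1 !mul1r ler_wpM2l ?mulr_ge0 ?powR_ge0 ?(ltW p0)//.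
exact: ler_cmod_dist.
Qed.

End nonlinearity.

(** * Step functions of time *)

Section step_functions.
Context {R : realType}.
Variable mu : {measure set (measurableTypeR R) -> \bar R}.

Import HBNNSimple.

(** The distance in [L^2] between two curves need not be a measurable function of
time, so the bound is read off the simple functions below the integrand. *)
Lemma integral_le_cst (D : set (measurableTypeR R)) (f : R -> \bar R) (c : R) :
  measurable D -> 0 <= c -> (forall t, D t -> 0 <= f t <= c%:E)%E ->
  (\int[@leb R]_(t in D) f t <= c%:E * leb D)%E.
Proof.
move=> mD c0 fc.
rewrite ge0_integralE; last by move=> t /fc/andP[].
apply: ge_ereal_sup => _ [g /= gf <-].
rewrite -integralT_nnsfun -(integral_cst _ mD) (integral_mkcond D).
apply: ge0_le_integral => //.
- by move=> t _; rewrite lee_fin fun_ge0.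
- by apply/measurable_EFinP.
- exact/(measurable_restrictT _ _).1.
move=> t _; apply: le_trans (gf t) _; rewrite /patch.
by case: ifPn => //; rewrite inE => /fc/andP[].
Qed.

Variables (kappa : R -> nat) (N : nat).
Hypothesis mkappa : forall k, measurable (kappa @^-1` [set k] : set (measurableTypeR R)).
Hypothesis kappaN : forall t, (kappa t < N)%N.

Lemma measurable_step (S : set nat) :
  measurable (kappa @^-1` S : set (measurableTypeR R)).
Proof.
rewrite (_ : kappa @^-1` S = \bigcup_(k in S) (kappa @^-1` [set k])).
  exact: bigcup_measurable.
apply/seteqP; split => [t St|t [k Sk /= tk]]; last by rewrite /preimage/= tk.
by exists (kappa t); [exact: St|exact: erefl].
Qed.

Lemma step_simple_L2 (g : nat -> R -> R[i]) :
  (forall k, (k < N)%N -> cLp mu 2%:E (g k)) -> simple_L2 mu (fun t => g (kappa t)).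
Proof.
move=> gL; split.
- apply: (@sub_finite_set _ _ [set` [seq g k | k <- iota 0 N]]); last exact: finite_seq.
  move=> _ [t _ <-] /=; apply/mapP; exists (kappa t) => //.
  by rewrite mem_iota /=.
- move=> v; rewrite (_ : _ @^-1` _ = kappa @^-1` [set k | g k = v]) //.
  exact: measurable_step.
- by move=> t; exact: gL.
Qed.

(** The integral of a simple function is a sum over its values, and different
indices may share a value: the preimage of a value is the disjoint union of the
cells whose index is sent to it. *)
Lemma step_simple_integral (D : set R) (g : nat -> R -> R[i]) (x : R) :
  measurable (D : set (measurableTypeR R)) -> (leb D < +oo)%E ->
  simple_integral D (fun t => g (kappa t)) x =
  \sum_(k < N) (fine (leb (D `&` kappa @^-1` [set (k : nat)])))%:C * g k x.
Proof.
move=> mD Dfin; rewrite /simple_integral.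
set s := fun t => g (kappa t); pose r := undup [seq g k | k <- iota 0 N].
have mDk (k : nat) : measurable (D `&` kappa @^-1` [set k] : set (measurableTypeR R)).
  exact: measurableI.
have fin_sub (A : set (measurableTypeR R)) : measurable A ->
    leb (D `&` A) \is a fin_num.
  move=> mA; rewrite ge0_fin_numE//; apply: le_lt_trans Dfin.
  by apply: le_measure; rewrite ?inE//; exact: measurableI.
rewrite (fsbig_widen _ [set` r]); last 2 first.
- move=> _ [t _ <-] /=; rewrite mem_undup; apply/mapP; exists (kappa t) => //.
  by rewrite mem_iota/=.
- move=> v [_ vs] /=; rewrite (_ : s @^-1` [set v] = set0) ?setI0 ?measure0 ?mul0r//.
  by apply/seteqP; split => // t stv; apply: vs; exists t.
rewrite -fsbig_seq ?undup_uniq//.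
transitivity (\sum_(v <- r) \sum_(k < N | g k == v)
    (fine (leb (D `&` kappa @^-1` [set (k : nat)])))%:C * g k x).
  apply: eq_bigr => v _.
  under [RHS]eq_bigr => k /eqP -> do [].
  rewrite -mulr_suml -rmorph_sum/=; congr ((_)%:C * _).
  rewrite sum_fine; last by move=> k _; exact: fin_sub.
  rewrite -(@measure_bigsetU_ord_cond _ _ _ leb N (fun k => g k == v)
    (fun k : 'I_N => D `&` kappa @^-1` [set (k : nat)])); last 2 first.
  - by move=> k _; exact: mDk.
  - by move=> i j _ _ [t [[_ /= ti] [_ /= tj]]]; apply/val_inj; rewrite /= -ti.
  congr (fine (leb _)); rewrite -bigcup_seq_cond.
  apply/seteqP; split => [t [Dt stv]|t [k /= /andP[kN /eqP gk] [Dt /= tk]]].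
    by exists (Ordinal (kappaN t)) => //=; rewrite mem_index_enum/=; apply/eqP.
  by split => //; rewrite /s/= tk.
rewrite (exchange_big_dep predT)//=; apply: eq_bigr => k _.
rewrite (big_rem (g k))/=; last first.
  by rewrite mem_undup; apply/mapP; exists (k : nat) => //; rewrite mem_iota/=.
rewrite eqxx big_seq_cond big1 ?addr0// => v /andP[+ /eqP gv].
by rewrite -gv mem_rem_uniqF ?undup_uniq.
Qed.

End step_functions.

Section dyadic.
Context {R : realType}.
Variable T : R.
Hypothesis T0 : 0 < T.

Definition mesh n : R := T * 2^-1 ^+ n.

(** The index is capped at the last cell, so that it takes finitely many values
on the whole line and not only on [(0, T)]. *)
Definition dyadic_index n (t : R) : nat := minn (Num.truncn (t / mesh n)) (2 ^ n).-1.

Lemma mesh_gt0 n : 0 < mesh n.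
Proof. by rewrite mulr_gt0// exprn_gt0// invr_gt0. Qed.

Lemma meshS n : mesh n.+1 = mesh n / 2.
Proof. by rewrite /mesh exprS mulrCA mulrC. Qed.

Lemma mesh_total n : (2 ^ n)%:R * mesh n = T.
Proof.
by rewrite /mesh mulrCA natrX -exprMn mulfV ?pnatr_eq0// expr1n mulr1.
Qed.

Lemma mesh_le_total n k : (k <= 2 ^ n)%N -> k%:R * mesh n <= T.
Proof.
by move=> kn; rewrite -(mesh_total n) ler_wpM2r ?ler_nat// ltW// mesh_gt0.
Qed.

Lemma mesh0 : mesh 0 = T.
Proof. by rewrite /mesh expr0 mulr1. Qed.

Lemma dyadic_index_lt n t : (dyadic_index n t < 2 ^ n)%N.
Proof. by rewrite /dyadic_index gtn_min ltn_predL expn_gt0 orbT. Qed.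

Lemma dyadic_index_itv n t : 0 < t < T ->
  (dyadic_index n t)%:R * mesh n <= t < (dyadic_index n t).+1%:R * mesh n.
Proof.
move=> /andP[t0 tT]; have d0 := mesh_gt0 n.
have /truncn_itv/andP[lo hi] : 0 <= t / mesh n by rewrite divr_ge0// ltW.
have kE : dyadic_index n t = Num.truncn (t / mesh n).
  apply/minn_idPl; rewrite -ltnS prednK ?expn_gt0// -(ltr_nat R).
  by apply: le_lt_trans lo _; rewrite ltr_pdivrMr// mesh_total.
by rewrite kE -ler_pdivlMr// lo -ltr_pdivrMr.
Qed.

Lemma dyadic_index_uniq n t k : 0 < t < T ->
  k%:R * mesh n <= t < k.+1%:R * mesh n -> dyadic_index n t = k.
Proof.
move=> tT /andP[kt tk]; have /andP[it ti] := dyadic_index_itv n tT.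
have d0 := mesh_gt0 n.
have := le_lt_trans kt ti; have := le_lt_trans it tk.
by rewrite !ltr_pM2r// !ltr_nat !ltnS => ik ki; apply/eqP; rewrite eqn_leq ik.
Qed.

Lemma dyadic_indexS n t : 0 < t < T ->
  dyadic_index n.+1 t = (dyadic_index n t).*2 \/
  dyadic_index n.+1 t = (dyadic_index n t).*2.+1.
Proof.
move=> tT; have /andP[it ti] := dyadic_index_itv n tT.
set k := dyadic_index n t in it ti *; have d0 := mesh_gt0 n.
have k2 : k.*2%:R = 2 * k%:R :> R by rewrite -mul2n natrM.
have [tm|tm] := ltP t (k.*2.+1%:R * mesh n.+1); [left|right];
  apply: dyadic_index_uniq => //; rewrite ?tm ?andbT/=.
- by rewrite k2 meshS; lra.
- move: ti; rewrite -[k.+1]addn1 -[k.*2.+2]addn2 !natrD k2 meshS; lra.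
Qed.

Lemma measurable_dyadic_index n k :
  measurable (dyadic_index n @^-1` [set k] : set (measurableTypeR R)).
Proof.
apply: is_interval_measurable => s t /= sk tk u /andP[su ut].
have homo a b : a <= b -> (dyadic_index n a <= dyadic_index n b)%N.
  move=> ab; rewrite /dyadic_index leq_min geq_minr andbT.
  apply: leq_trans (geq_minl _ _) _; apply: le_truncn.
  by rewrite ler_wpM2r// invr_ge0 ltW// mesh_gt0.
by apply/eqP; rewrite eqn_leq -{1}tk -{1}sk !homo.
Qed.

Lemma leb_dyadic n t k : 0 < t < T ->
  fine (leb (`]0, t[ `&` dyadic_index n @^-1` [set k])) =
  if (k < dyadic_index n t)%N then mesh n
  else if (k == dyadic_index n t) then t - k%:R * mesh n else 0.
Proof.
move=> tT; have /andP[t0 tltT] := tT; have /andP[it ti] := dyadic_index_itv n tT.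
set m := dyadic_index n t in it ti *; have d0 := mesh_gt0 n.
set A := _ `&` _.
have mA : measurable (A : set (measurableTypeR R)).
  by apply: measurableI => //; exact: measurable_dyadic_index.
have A_in u : A u -> k%:R * mesh n <= u < k.+1%:R * mesh n /\ 0 < u < t.
  move=> [/=]; rewrite in_itv/= => /andP[u0 ut] <-; split; last by rewrite u0.
  by apply: dyadic_index_itv; rewrite u0 (lt_trans ut).
have in_A u : k%:R * mesh n <= u < k.+1%:R * mesh n -> 0 < u < t -> A u.
  move=> uk /andP[u0 ut]; split; first by rewrite /= in_itv/= u0.
  by apply: dyadic_index_uniq => //; rewrite u0 (lt_trans ut).
have leb_itv (a b : R) (l1 l2 : bool) : a <= b ->
    leb [set` Interval (BSide l1 a) (BSide l2 b)] = (b - a)%:E.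
  move=> ab; rewrite -[LHS]/(lebesgue_measure _) lebesgue_measure_itv/= lte_fin.
  case: ltP => [//|ba]; rewrite (_ : b = a) ?subrr//.
  by apply/eqP; rewrite eq_le ab ba.
(* the first cell loses the origin, so A is an interval up to its left end *)
have sandwich (a b : R) : a <= b ->
    (forall u, A u -> a <= u < b) -> (forall u, a < u < b -> A u) ->
    fine (leb A) = b - a.
  move=> ab Aab abA.
  suff -> : leb A = (b - a)%:E by [].
  apply/eqP; rewrite eq_le; apply/andP; split.
    rewrite -(leb_itv a b true true ab).
  by apply: le_measure; rewrite ?inE.
  rewrite -(leb_itv a b false true ab).
  by apply: le_measure; rewrite ?inE.
have kS : k.+1%:R = k%:R + 1 :> R by rewrite -addn1 natrD.
have kd0 : 0 <= k%:R * mesh n by rewrite mulr_ge0// ltW.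
case: ifPn => [km|].
  have kmt : k.+1%:R * mesh n <= t.
    by apply: le_trans it; rewrite ler_wpM2r ?ler_nat// ltW.
  rewrite (sandwich (k%:R * mesh n) (k.+1%:R * mesh n)).
  - by rewrite kS; ring.
  - by rewrite ler_wpM2r ?ler_nat// ltW.
  - by move=> u /A_in[].
  - move=> u /andP[ku uk]; apply: in_A; first by rewrite ltW.
    by rewrite (le_lt_trans kd0)//= (lt_le_trans uk).
rewrite -leqNgt => mk; case: ifPn => [/eqP km|km].
  rewrite (sandwich (k%:R * mesh n) t)//.
  - by rewrite km.
  - by move=> u /A_in[/andP[-> _] /andP[]].
  - move=> u /andP[ku ut]; apply: in_A; last by rewrite ut (le_lt_trans kd0).
    by rewrite ltW//= (lt_trans ut)// km.
have mltk : (m < k)%N by rewrite ltn_neqAle eq_sym km.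
rewrite (_ : A = set0) ?measure0//; apply/seteqP; split => // u /A_in[].
move=> /andP[ku _] /andP[_ ut].
have : k%:R * mesh n < m.+1%:R * mesh n.
  by apply: le_lt_trans ku (lt_trans ut ti).
by rewrite ltr_pM2r// ltr_nat ltnS leqNgt mltk.
Qed.

End dyadic.

(** * Differential equations in [L^2] *)

Section euler.
Context {R : realType}.
Variable mu : {measure set (measurableTypeR R) -> \bar R}.
Variables (Phi : (R -> R[i]) -> R -> R[i]) (u0 : R -> R[i]) (L M T : R).

Definition unit_ball (f : R -> R[i]) : Prop :=
  cLp mu 2%:E f /\ norm_le mu 2 (fun x => f x - u0 x) 1.

Hypothesis L0 : 0 < L.
Hypothesis M0 : 0 < M.
Hypothesis T0 : 0 < T.
Hypothesis TM : T * M <= 2^-1.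
Hypothesis TL : T * L <= 2^-1.
Hypothesis u0L : cLp mu 2%:E u0.
Hypothesis PhiL : forall f, cLp mu 2%:E f -> cLp mu 2%:E (Phi f).
Hypothesis Phi_bounded : forall f, unit_ball f -> norm_le mu 2 (Phi f) M.
Hypothesis Phi_lipschitz : forall f g r, unit_ball f -> unit_ball g -> 0 < r ->
  norm_le mu 2 (fun x => f x - g x) r ->
  norm_le mu 2 (fun x => Phi f x - Phi g x) (L * r).

Let one_le2 : (1 : R) <= 2. Proof. by rewrite ler1n. Qed.
Let one_lt2 : (1 : R) < 2. Proof. by rewrite ltr1n. Qed.
Let half_le1 : (2^-1 : R) <= 1. Proof. by rewrite invf_le1// ler1n. Qed.
Let gt02 : (0 : R) < 2. Proof. by []. Qed.

Local Notation cmeas := (@cmeasurable R _ (measurableTypeR R)).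
Local Notation mesh := (mesh T).
Local Notation index := (dyadic_index T).
Local Notation mesh_gt0 := (mesh_gt0 T0).

Fixpoint euler n k : R -> R[i] :=
  if k is k'.+1 then fun x => euler n k' x + (mesh n)%:C * Phi (euler n k') x
  else u0.

Lemma euler_cLp n k : cLp mu 2%:E (euler n k).
Proof.
elim: k => [//|k IH] /=.
rewrite (_ : (fun x => _) = (fun x => (mesh n)%:C * Phi (euler n k) x + euler n k x)).
  by apply: cLp_lin => //; exact: PhiL.
by apply/funext => x; rewrite addrC.
Qed.

Let mE n k : cmeas (euler n k). Proof. exact: (euler_cLp n k).1. Qed.
Let mPE n k : cmeas (Phi (euler n k)).
Proof. exact: (PhiL (euler_cLp n k)).1. Qed.
Let mu0 : cmeas u0. Proof. exact: u0L.1. Qed.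

Lemma euler_step n k : unit_ball (euler n k) ->
  norm_le mu 2 (fun x => euler n k.+1 x - euler n k x) (mesh n * M).
Proof.
move=> /Phi_bounded PM.
rewrite (_ : (fun x => _) = (fun x => (mesh n)%:C * Phi (euler n k) x)); last first.
  by apply/funext => x /=; rewrite addrC addKr.
by rewrite -[X in X * M](cmodR (ltW (mesh_gt0 n))); exact: norm_leZ gt02 (mPE _ _) PM.
Qed.

(** Each step moves by at most [mesh n * M], and [T * M <= 1/2] keeps the polygon
inside the ball on which [Phi] is controlled. *)
Lemma euler_near n k : (k <= 2 ^ n)%N ->
  norm_le mu 2 (fun x => euler n k x - u0 x) (k%:R * mesh n * M).
Proof.
elim: k => [|k IH] kn; first by rewrite !mul0r; exact: norm_le_subrr.
have {}IH := IH (ltnW kn).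
have kb : unit_ball (euler n k).
  split; first exact: euler_cLp.
  apply: norm_leW IH; apply: (@le_trans _ _ (T * M)); last exact: le_trans TM half_le1.
  by rewrite ler_wpM2r ?(ltW M0)// mesh_le_total// ltnW.
have := norm_le_triangle one_le2 (mE _ _) (mE _ _) mu0 (euler_step kb) IH.
by congr (norm_le _ _ _ _); rewrite -natr1; ring.
Qed.

Lemma euler_unit_ball n k : (k <= 2 ^ n)%N -> unit_ball (euler n k).
Proof.
move=> kn; split; first exact: euler_cLp.
apply: norm_leW (euler_near kn); apply: (@le_trans _ _ (T * M)); last exact: le_trans TM half_le1.
by rewrite ler_wpM2r ?(ltW M0)// mesh_le_total.
Qed.

(** Let [d] be the coarse step and [e_k] the distance of the nodes at time [k d].
One coarse step is compared with two fine ones: the first fine slope errs by at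
most [L e_k], the second by [L (e_k + d M / 2)], whence
[e_(k+1) <= e_k + d L e_k + d^2 L M / 4].  As [k d L <= T L <= 1/2], the claimed
bound entails [e_k <= d M / 4], which closes the induction. *)
Lemma euler_refine n k : (k <= 2 ^ n)%N ->
  norm_le mu 2 (fun x => euler n.+1 k.*2 x - euler n k x)
    (k%:R * mesh n * L * (M * mesh n / 2)).
Proof.
have dbl j : (j <= 2 ^ n)%N -> (j.*2 <= 2 ^ n.+1)%N.
  by rewrite expnS mul2n leq_double.
elim: k => [|k IH] kn; first by rewrite !mul0r; exact: norm_le_subrr.
have {}IH := IH (ltnW kn); have d0 := mesh_gt0 n.
have Md0 : 0 < M * mesh n by exact: mulr_gt0.
have kn2 : (k.*2.+1 <= 2 ^ n.+1)%N by apply: leq_trans (dbl _ kn); rewrite doubleS.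
have b1 : unit_ball (euler n k) := euler_unit_ball (ltnW kn).
have b2 : unit_ball (euler n.+1 k.*2) := euler_unit_ball (dbl _ (ltnW kn)).
have b3 : unit_ball (euler n.+1 k.*2.+1) := euler_unit_ball kn2.
have kL : k%:R * mesh n * L <= 2^-1.
  apply: le_trans TL; rewrite ler_wpM2r ?(ltW L0)//.
  by rewrite mesh_le_total// ltnW.
have d1 : norm_le mu 2 (fun x => euler n.+1 k.*2 x - euler n k x) (M * mesh n / 4).
  apply: norm_leW IH.
  have := ler_wpM2r (ltW Md0) kL; lra.
have d2 : norm_le mu 2 (fun x => euler n.+1 k.*2.+1 x - euler n k x) (3 * (M * mesh n / 4)).
  have := norm_le_triangle one_le2 (mE _ _) (mE _ _) (mE _ _) (euler_step b2) d1.
  by apply: norm_leW; rewrite meshS; lra.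
have p1 : norm_le mu 2 (fun x => Phi (euler n.+1 k.*2) x - Phi (euler n k) x)
    (L * (M * mesh n / 4)).
  by apply: Phi_lipschitz => //; rewrite divr_gt0.
have p2 : norm_le mu 2 (fun x => Phi (euler n.+1 k.*2.+1) x - Phi (euler n k) x)
    (L * (3 * (M * mesh n / 4))).
  by apply: Phi_lipschitz => //; rewrite mulr_gt0// divr_gt0.
pose c := mesh n.+1.
have c0 : 0 <= c by rewrite ltW ?mesh_gt0.
have mP j : cmeas (fun x => Phi (euler n.+1 j) x - Phi (euler n k) x).
  exact: cmeasurableB.
have {}p1 := norm_leZ c%:C gt02 (mP _) p1.
have {}p2 := norm_leZ c%:C gt02 (mP _) p2.
have := norm_leD one_le2 _ _ (norm_leD one_le2 _ _ IH p1) p2.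
have mcP j := cmeasurableZ c%:C (mP j).
have mEE j : cmeas (fun x => euler n.+1 j x - euler n k x) by exact: cmeasurableB.
move=> /(_ (cmeasurableD (mEE _) (mcP _)) (mcP _) (mEE _) (mcP _)).
rewrite !cmodR//; congr (norm_le _ _ _ _).
- apply/funext => x; rewrite doubleS /= -/c.
  have -> : (mesh n)%:C = c%:C + c%:C.
    by rewrite -rmorphD /c meshS; congr (_%:C); field.
  by ring.
- by rewrite /c meshS -[k.+1]addn1 natrD; field.
Qed.

Definition euler_step_fun n t : R -> R[i] := euler n (index n t).

Local Notation w := euler_step_fun.

(** The fine cell of [t] is the left or the right half of its coarse cell; in the
second case one fine step is added to the bound of [euler_refine]. *)
Lemma euler_step_fun_dist n t : 0 < t < T ->
  norm_le mu 2 (fun x => w n.+1 t x - w n t x) (2 * M * mesh n - 2 * M * mesh n.+1).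
Proof.
move=> tT; have d0 := mesh_gt0 n.
have Md0 : 0 < M * mesh n by exact: mulr_gt0.
have kn : (index n t <= 2 ^ n)%N by rewrite ltnW// dyadic_index_lt.
have kL : (index n t)%:R * mesh n * L <= 2^-1.
  by apply: le_trans TL; rewrite ler_wpM2r ?(ltW L0)// mesh_le_total.
have d1 : norm_le mu 2 (fun x => euler n.+1 (index n t).*2 x - w n t x) (M * mesh n / 4).
  apply: norm_leW (euler_refine kn).
  have := ler_wpM2r (ltW Md0) kL; lra.
rewrite /w; have [->|->] := dyadic_indexS T0 n tT.
  by apply: norm_leW d1; rewrite meshS; lra.
have b2 : unit_ball (euler n.+1 (index n t).*2).
  by apply: euler_unit_ball; rewrite expnS mul2n leq_double.
have := norm_le_triangle one_le2 (mE _ _) (mE _ _) (mE _ _) (euler_step b2) d1.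
by apply: norm_leW; rewrite meshS; lra.
Qed.

Lemma euler_limit : exists u : R -> R -> R[i], forall t, 0 < t < T ->
  cmeas (u t) /\
  forall n, norm_le mu 2 (fun x => u t x - w n t x) (2 * M * mesh n).
Proof.
suff /choice[u uP] : forall t, exists f : R -> R[i], 0 < t < T ->
    cmeas f /\ forall n, norm_le mu 2 (fun x => f x - w n t x) (2 * M * mesh n).
  by exists u.
move=> t; have [tT|] := boolP (0 < t < T); last by exists (fun=> 0).
have [f [mf fw _]] : exists f, [/\ cmeas f,
    forall n, norm_le mu 2 (fun x => f x - w n t x) (2 * M * mesh n)
    & \forall x \ae mu, cmod (w n t x) @[n --> \oo] --> cmod (f x)].
  apply: riesz_fischer => // n.
  - exact: mE.
  - by rewrite !mulr_ge0// ltW// mesh_gt0.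
  - exact: euler_step_fun_dist.
by exists f.
Qed.

Lemma euler_sum n m x : euler n m x - u0 x =
  \sum_(0 <= k < m) (mesh n)%:C * Phi (euler n k) x.
Proof.
elim: m => [|m IH]; first by rewrite subrr big_geq.
by rewrite big_nat_recr//= -IH addrAC.
Qed.

(** Summing the slopes over the full cells gives the increment of the nodes; the
last cell contributes the part of it before [t]. *)
Lemma euler_simple_integral n t x : 0 < t < T ->
  simple_integral `]0, t[ (fun tau => Phi (w n tau)) x =
  (w n t x - u0 x) + (t - (index n t)%:R * mesh n)%:C * Phi (w n t) x.
Proof.
move=> tT; set m := index n t.
have mN : (m < 2 ^ n)%N by exact: dyadic_index_lt.
have leb_lty : (leb `]0%R, t[%classic < +oo)%E.
  by rewrite -[X in (X < _)%E]/(lebesgue_measure _) lebesgue_measure_itv/=; case: ifP => _; rewrite ltry.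
rewrite (@step_simple_integral _ (index n) (2 ^ n) _ _ _ (fun k => Phi (euler n k)))//; last 2 first.
- by move=> k; exact: measurable_dyadic_index.
- by move=> s; exact: dyadic_index_lt.
under eq_bigr do rewrite leb_dyadic//.
rewrite -(big_mkord predT (fun k => (if (k < m)%N then mesh n
  else if k == m then t - k%:R * mesh n else 0)%:C * Phi (euler n k) x)).
rewrite (big_cat_nat (n := m))//=; last exact: ltnW.
rewrite {2}/w euler_sum; congr (_ + _).
  by apply: eq_big_nat => k /andP[_ km]; rewrite km.
rewrite big_ltn// ltnn eqxx big_nat big1 ?addr0// => k /andP[mk _].
by rewrite ltnNge (ltnW mk)/= gtn_eqF// mul0r.
Qed.

Lemma cvg_L2dist0 (F : nat -> R -> R[i]) (G : nat -> R -> R[i]) (c : R) :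
  (forall n, norm_le mu 2 (fun x => F n x - G n x) (c * mesh n)) ->
  L2dist mu (F n) (G n) @[n --> \oo] --> 0%E.
Proof.
move=> FG.
have cm : (c * mesh n)%:E @[n --> \oo] --> 0%E.
  apply: cvg_EFin; first exact: nearW.
  rewrite -(mulr0 c) -(mulr0 T); apply: cvgMr; apply: cvgMr.
  by apply: cvg_expr; rewrite gtr0_norm ?invr_gt0// invf_lt1.
apply: squeeze_cvge (cvg_cst 0%E) cm.
by apply: nearW => n; rewrite Lnorm_ge0/=; exact: FG.
Qed.

(** The step functions [w n] converge to the solution uniformly in time, and by
the Lipschitz property so do the slopes [Phi (w n)] to its derivative. *)
Theorem euler_solution : exists u : R -> R -> R[i], Linfty_L2 mu T u /\
  forall t, 0 < t < T -> exists2 v : R -> R[i],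
    is_bochner_integral mu `]0, t[ (fun tau => Phi (u tau)) v
    & forall x, u t x = u0 x + v x.
Proof.
have [u uP] := euler_limit.
have mu_ t : 0 < t < T -> cmeas (u t) by move=> /uP[].
have uw t n : 0 < t < T -> norm_le mu 2 (fun x => u t x - w n t x) (2 * M * mesh n).
  by move=> /uP[].
have R0 n : 0 < 2 * M * mesh n by rewrite !mulr_gt0 ?mesh_gt0.
have wb n t : unit_ball (w n t).
  by apply: euler_unit_ball; rewrite ltnW// dyadic_index_lt.
have uL t : 0 < t < T -> cLp mu 2%:E (u t).
  by move=> tT; exact: cLp_near (mu_ _ tT) (wb 0%N t).1 (uw _ _ tT).
have ub t : 0 < t < T -> unit_ball (u t).
  move=> tT; split; first exact: uL.
  have := uw _ 0%N tT; have := dyadic_index_lt T 0 t.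
  rewrite /w expn0 ltnS leqn0 => /eqP -> /=; apply: norm_leW.
  by rewrite mesh0 -mulrA (mulrC M) -ler_pdivlMl// mulr1.
have mN n k : measurable (index n @^-1` [set k] : set (measurableTypeR R)).
  exact: measurable_dyadic_index.
have kN n t : (index n t < 2 ^ n)%N by exact: dyadic_index_lt.
have w_simple n : simple_L2 mu (w n).
  by apply: (step_simple_L2 (mN n) (kN n)) => k _; exact: euler_cLp.
have Pw_simple n : simple_L2 mu (fun t => Phi (w n t)).
  apply: (step_simple_L2 (g := fun k => Phi (euler n k)) (mN n) (kN n)) => k _.
  exact/PhiL/euler_cLp.
exists u; split; first split.
- exists w; split=> //; apply: aeW => t; rewrite /= in_itv/= => tT.
  by apply: (@cvg_L2dist0 (fun=> u t) _ (2 * M)) => n; exact: uw.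
- have [r u0r] := cLp_norm_le u0L; exists (1 + r).
  apply: aeW => t tT; split; first exact: uL.
  have := norm_leD one_le2 (cmeasurableB (mu_ _ tT) mu0) mu0 (ub _ tT).2 u0r.
  by congr (norm_le _ _ _ _); apply/funext => x; rewrite subrK.
move=> t tT; exists (fun x => u t x - u0 x); last by move=> x; rewrite addrC subrK.
have sub tau : `]0, t[%classic tau -> 0 < tau < T.
  rewrite /= in_itv/= => /andP[-> /lt_trans]; apply.
  by case/andP: tT.
have Pdist tau n : `]0, t[%classic tau ->
    norm_le mu 2 (fun x => Phi (u tau) x - Phi (w n tau) x) (L * (2 * M) * mesh n).
  move=> /sub tauT; rewrite -mulrA.
  by apply: Phi_lipschitz => //; [exact: ub|exact: uw].
split; first exact: cLpB one_le2 (uL _ tT) u0L.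
split; first by apply: aeW => tau /sub/uL/PhiL.
exists (fun n tau => Phi (w n tau)); split.
- split => //; apply: aeW => tau tauD.
  by apply: (@cvg_L2dist0 (fun=> Phi (u tau)) _ (L * (2 * M))) => n; exact: Pdist.
- have cm : ((L * (2 * M) * mesh n)%:E * leb `]0%R, t[%classic)%E @[n --> \oo] --> 0%E.
    have -> : leb `]0%R, t[%classic = t%:E.
      rewrite -[LHS]/(lebesgue_measure _) lebesgue_measure_itv/= lte_fin.
      by have /andP[-> _] := tT; rewrite oppr0 addr0.
    under eq_fun do rewrite -EFinM.
    apply: cvg_EFin; first exact: nearW.
    rewrite -(mul0r t); apply: cvgMl.
    rewrite -(mulr0 (L * (2 * M))) -(mulr0 T); apply: cvgMr; apply: cvgMr.
    by apply: cvg_expr; rewrite gtr0_norm ?invr_gt0// invf_lt1.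
  apply: squeeze_cvge (cvg_cst 0%E) cm.
  apply: nearW => n; rewrite integral_ge0//=; last by move=> tau _; exact: Lnorm_ge0.
  apply: integral_le_cst => //.
    by rewrite !mulr_ge0 ?ltW// mesh_gt0.
  by move=> tau tauD; rewrite Lnorm_ge0/=; exact: Pdist.
- apply: (@cvg_L2dist0 _ _ (3 * M)) => n.
  have d0 := mesh_gt0 n.
  have /andP[it ti] := dyadic_index_itv T0 n tT.
  have c0 : 0 <= t - (index n t)%:R * mesh n by rewrite subr_ge0.
  have c1 : t - (index n t)%:R * mesh n <= mesh n.
    by move: ti; rewrite -[_.+1]addn1 natrD; lra.
  have := norm_leZ (t - (index n t)%:R * mesh n)%:C gt02 (mPE _ _) (Phi_bounded (wb n t)).
  rewrite cmodR// => H.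
  have {}H : norm_le mu 2 (fun x => (t - (index n t)%:R * mesh n)%:C * Phi (w n t) x) (M * mesh n).
    by apply: norm_leW H; rewrite mulrC ler_wpM2l// ltW.
  have := norm_leD one_le2 (cmeasurableB (mE _ _) (mu_ _ tT))
    (cmeasurableZ _ (mPE _ _)) (norm_le_distC (uw _ n tT)) H.
  rewrite (_ : 2 * M * mesh n + M * mesh n = 3 * M * mesh n); last by ring.
  congr (norm_le _ _ _ _); apply/funext => x.
  rewrite euler_simple_integral// /w.
  by ring.
Qed.

End euler.

(** * Fourier multipliers *)

Section multiplier.
Context {R : realType}.

Lemma cLp_infty_ae d (T : measurableType d) (mu : {measure set T -> \bar R})
    (h : T -> R[i]) : cLp mu +oo%E h ->
  exists2 H : R, 0 < H & \forall x \ae mu, cmod (h x) <= H.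
Proof.
move=> [_]; rewrite /cLnorm unlock; case: ifPn => [_ hy|mu0 _]; last first.
  (* here the norm is 0 by convention and says nothing about h *)
  exists 1 => //; exists setT; split => //.
  by apply/eqP; rewrite eq_le measure_ge0 andbT leNgt.
have [H hH] : exists H : R, (ess_sup mu (abse \o (fun x => (cmod (h x))%:E)) <= H%:E)%E.
  move: hy; case: ess_sup => [H _|//|_]; first by exists H.
  by exists 0; rewrite leNye.
exists (`|H| + 1); first by rewrite ltr_pwDr.
move/ess_supP : hH; apply: filterS => x /=.
rewrite lee_fin ger0_norm ?cmod_ge0// => /le_trans; apply.
by rewrite (le_trans (ler_norm H))// lerDl.
Qed.

(** Plancherel's isometry turns [B] into multiplication by [h]. *)
Lemma multiplier_bounded (A : R -> R)
  (mu : {measure set (measurableTypeR R) -> \bar R})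
  (phi : R[i] -> R -> R[i]) (pi : {measure set (@Cborel R) -> \bar R})
  (FT : (R -> R[i]) -> @Cborel R -> R[i]) (h : @Cborel R -> R[i])
  (B : (R -> R[i]) -> R -> R[i]) :
  is_plancherel A mu phi pi FT -> is_fourier_multiplier mu pi FT h B ->
  exists2 H : R, 0 < H & forall f r, cLp mu 2%:E f ->
    norm_le mu 2 f r -> norm_le mu 2 (B f) (H * r).
Proof.
move=> hpi [/cLp_infty_ae[H H0 hH] _ BP]; exists H => // f r Lf fr.
have [LBf FTB] := BP f Lf.
rewrite /norm_le -(pl_isometry hpi LBf) -/(norm_le pi 2 (FT (B f)) (H * r)).
have mF := (pl_into hpi Lf).1; have mFB := (pl_into hpi LBf).1.
have Fr : norm_le pi 2 (FT f) r by rewrite /norm_le (pl_isometry hpi Lf).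
have gt02 : (0 : R) < 2 by [].
have := norm_leZ H%:C gt02 mF Fr; rewrite cmodR ?(ltW H0)//.
apply: norm_le_ae => //; first exact: cmeasurableZ.
apply: filterS2 FTB hH => x -> hx.
by rewrite !cmodM cmodR ?(ltW H0)// ler_wpM2r ?cmod_ge0.
Qed.

End multiplier.

Unset Implicit Arguments.

Theorem theorem5p1 (R : realType) (A : R -> R) (alpha a : R)
  (mu : {measure set (measurableTypeR R) -> \bar R})
  (phi : R[i] -> R -> R[i])
  (pi : {measure set (@Cborel R) -> \bar R})
  (FT : (R -> R[i]) -> @Cborel R -> R[i])
  (c : R[i] -> R[i])
  (hA : is_chebli_trimeche A alpha)
  (hmu : is_weighted_measure A mu)
  (hphi : forall lambda : R[i], is_eigenfunction A lambda (phi lambda))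
  (hst : standing_assumptions A phi alpha a)
  (hpi : is_plancherel A mu phi pi FT)
  (hc : is_c_function alpha a pi c)
  (p : R) (hp : 1 < p)
  (u0 : R -> R[i]) (hu0 : cLp mu 2%:E u0)
  (h : @Cborel R -> R[i]) (B : (R -> R[i]) -> R -> R[i])
  (hB : is_fourier_multiplier mu pi FT h B)
  (hBp : forall f : R -> R[i], cLp mu 2%:E f -> cLp mu (2 * p)%:E (B f))
  (hh : (ereal_sup [set s%:E *
            \int[leb]_(l in [set l : R | (0 <= l)%R /\ (s <= cmod (h l%:C))%R])
              (cmod (c l%:C) ^- 2)%:E | s in [set s : R | (0 < s)%R]]
         < +oo)%E) :
  exists2 T : R, 0 < T &
    exists u : R -> R -> R[i], is_local_solution mu B p u0 T u.
Proof.
have p0 : 0 < p by exact: lt_trans hp.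
have p'0 : 0 < p - 1 by rewrite subr_gt0.
have q1 : 1 < 2 * p by rewrite (lt_trans hp)// ltr_pMl// ltr1n.
have one_le2 : (1 : R) <= 2 by rewrite ler1n.
have [H H0 BH] := multiplier_bounded hpi hB.
have [_ Blin BFT] := hB.
have BL2 f : cLp mu 2%:E f -> cLp mu 2%:E (B f) by move=> /BFT[].
have [C C0 CP] := L2_Lq_bounded q1 Blin BL2 H0 BH hBp.
have [r0 u0r] := cLp_norm_le hu0; have r00 := norm_le_ge0 u0r.
(* a bound of B f in L^{2p} for f in the unit ball around u0 *)
pose s := C * (1 + r0).
have s0 : 0 < s by rewrite mulr_gt0// ltr_pwDl.
pose Phi (f : R -> R[i]) x : R[i] := (cmod (B f x) `^ p)%:C.
pose M := s `^ p; pose L := p * (2 * s) `^ (p - 1) * C.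
have M0 : 0 < M by rewrite powR_gt0.
have L0 : 0 < L by rewrite !mulr_gt0// powR_gt0// mulr_gt0.
have mB f : cLp mu 2%:E f -> @cmeasurable R _ (measurableTypeR R) (B f).
  by move=> /BL2[].
have Bs f : unit_ball mu u0 f -> norm_le mu (2 * p) (B f) s.
  move=> [Lf fu0]; apply: CP => //; first by rewrite ltr_pwDl.
  have := norm_leD one_le2 (cmeasurableB Lf.1 hu0.1) hu0.1 fu0 u0r.
  by congr (norm_le _ _ _ _); apply/funext => x; rewrite subrK.
have PhiM f : unit_ball mu u0 f -> norm_le mu 2 (Phi f) M.
  by move=> bf; apply: norm_le_cmod_powR => //; [exact: mB bf.1|exact: Bs].
have PhiL2 f : cLp mu 2%:E f -> cLp mu 2%:E (Phi f).
  move=> Lf; have [r Br] := cLp_norm_le (hBp f Lf).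
  apply: (norm_le_cLp (r := r `^ p)); last by apply: norm_le_cmod_powR => //; exact: mB.
  by apply: cmeasurableR; apply: measurable_cmod_powR; exact: mB.
have PhiL f g r : unit_ball mu u0 f -> unit_ball mu u0 g -> 0 < r ->
    norm_le mu 2 (fun x => f x - g x) r ->
    norm_le mu 2 (fun x => Phi f x - Phi g x) (L * r).
  move=> bf bg rgt0 fg; rewrite /L -[X in norm_le _ _ _ X]mulrA.
  apply: norm_le_powR_dist => //; try exact: Bs; rewrite ?mulr_gt0//.
  - exact: mB bf.1.
  - exact: mB bg.1.
  have Lfg := cLpB one_le2 bf.1 bg.1.
  apply: norm_le_aeq (CP _ _ rgt0 Lfg fg).
  - by rewrite mulr_gt0.
  - by apply: cmeasurableB; apply: mB; [exact: bf.1|exact: bg.1].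
  - exact: mB.
  by apply: filterS (linear_on_L2B Blin bf.1 bg.1) => x ->.
(* short enough for both the invariance of the ball and the stability of the scheme *)
pose T := (2 * (M + L))^-1.
have ML0 : 0 < M + L by rewrite addr_gt0.
have T0 : 0 < T by rewrite invr_gt0 mulr_gt0.
have TML : T * (M + L) = 2^-1.
  by rewrite /T; field; rewrite gt_eqF.
have TM : T * M <= 2^-1 by rewrite -TML ler_wpM2l ?(ltW T0)// lerDl ltW.
have TL : T * L <= 2^-1 by rewrite -TML ler_wpM2l ?(ltW T0)// lerDr ltW.
have [u [uLinf uP]] := euler_solution L0 M0 T0 TM TL hu0 PhiL2 PhiM PhiL.
exists T => //; exists u; split=> //; apply: aeW => t tT.
have [v vP uv] := uP t tT; exists v => //.
by apply: aeW => x; exact: uv.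
Qed.
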